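(* Suppose $\tau=w_0W_Q$. Then the following are equivalent: (0) $\mathcal I$ is $\tau$-standard; (i) for every $I\in\mathcal I$, the element $(\mathrm{id}W_{P_I},I)\in\underline W(\underline\lambda,\tau)$ has exactly one preimage under $\rho$; (ii) for every $I\in\mathcal I$ and every chain $I=I_r\subsetneq\dots\subsetneq I_m=[m]$ of covering relations in $\mathcal I$, with $Q^r=\bigcap_{j=r}^mP_{I_j}$: $\min_Q(\max_{Q_I}(\mathrm{id}W_{P_I}))=\max_Q(\min_{Q^r}(\mathrm{id}W_{P_I}))$; (iii) for every such $I$ and chain: $W_{P_I}\cap W^{Q_I}\subseteq W_{Q^r}\cap W^Q$; (iv) for every such $I$ and chain: $Q_I$ and $Q^r$ generate $P_I$, and every path in the Dynkin diagram of $G$ (visiting no vertex twice) connecting a vertex of $\Delta_{Q_I}\setminus\Delta_{Q^r}$ with a vertex of $\Delta_{Q^r}\setminus\Delta_{Q_I}$ contains a vertex not in $\Delta_{P_I}$.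
   Context: Let $\mathbb K$ be algebraically closed of characteristic zero, $G$ a connected, simply-connected, simple algebraic group over $\mathbb K$, $T\subseteq B$ maximal torus and Borel, $W$ the Weyl group with longest element $w_0$, $\Delta$ the simple roots, $W_\nu$ the stabilizer of a weight $\nu$. Parabolic subgroups contain $B$; for a parabolic $Q'$, $W_{Q'}$ is its Weyl group, $W^{Q'}\subseteq W$ the set of minimal-length representatives of $W/W_{Q'}$, and $\Delta_{Q'}=\{\alpha\in\Delta:s_\alpha\in W_{Q'}\}$; $W/W_{Q'}$ carries the Bruhat order; for $Q_1\subseteq Q_2$, $\pi_{Q_2}:W/W_{Q_1}\to W/W_{Q_2}$ is the projection and $\min_{Q_1},\max_{Q_1}$ give the minimal/maximal preimages. Standing data: dominant $\lambda_1,\dots,\lambda_m$, $\underline\lambda=(\lambda_1,\dots,\lambda_m)$, $\lambda=\sum\lambda_i$, $Q=BW_\lambda B$, $\tau\in W/W_Q$. $\mathcal I$ is a set of nonempty subsets of $[m]$ ordered by inclusion, graded of length $m-1$ (so $[m]\in\mathcal I$), satisfying ( * ): $\underline J\subseteq I\Rightarrow J\subseteq I$, where $\underline J=J$ if $J$ is minimal in $\mathcal I$ and otherwise $\underline J=\bigcup\{J\setminus K:K\in\mathcal I\text{ covered by }J\}$; $\lambda_I=\sum_{i\in\underline I}\lambda_i$, $P_I=BW_{\lambda_I}B$, $Q_I=\bigcap_{J\in\mathcal I,J\subseteq I}P_J$. $W(\underline\lambda,\tau)$: pairs $(\theta,I)$, $\theta\in W/W_Q$, $\theta\le\tau$, $I\in\mathcal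 I$, product order. $\underline W(\underline\lambda,\tau)=\bigsqcup_{I}\{\theta\in W/W_{P_I}:\theta\le\pi_{P_I}(\tau)\}\times\{I\}$, ordered by the transitive closure of: $(\theta,I)\ge(\phi,J)$ iff $I\supseteq J$ and $\max_Q(\theta)\ge\min_Q(\phi)$. A chain in $\underline W(\underline\lambda,\tau)$ is $\tau$-standard if it has a defining chain: a chain in $W(\underline\lambda,\tau)$ with the same index sets mapping elementwise onto it under $(\theta,I)\mapsto(\pi_{P_I}(\theta),I)$. $D(\underline\lambda,\tau)$ is the set of elements of $W(\underline\lambda,\tau)$ lying in a defining chain of some maximal $\tau$-standard chain, ordered by: $x\succeq y$ iff $x\ge y$ and both lie in the defining chain of a common maximal $\tau$-standard chain. $\rho:D(\underline\lambda,\tau)\to\underline W(\underline\lambda,\tau)$, $(\theta,I)\mapsto(\pi_{P_I}(\theta),I)$. $\mathcal I$ is $\tau$-standard if $\rho$ is an isomorphism of posets. *)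

(* Defs.v *)
From HB Require Import structures.
From mathcomp Require Import all_boot all_order all_algebra.
From Stdlib Require Import ClassicalEpsilon.
From Stdlib Require Relation_Operators.

Set Implicit Arguments.
Unset Strict Implicit.
Unset Printing Implicit Defensive.

Import Order.TTheory GRing.Theory Num.Theory.
Local Open Scope ring_scope.

Section Weyl.
(* rank n, Cartan matrix A with A i j = <alpha_i, alpha_j^vee>          *)
Variable n : nat.
Variable A : 'M[int]_n.

(* Generalized Cartan matrix of finite type: all principal minors > 0 (Kac). *)
Definition finite_type_cartan : Prop :=
  [/\ forall i, A i i = 2,
      forall i j, i != j -> A i j <= 0,
      forall i j, (A i j == 0) = (A j i == 0)
    & forall S : {set 'I_n}, S != set0 ->
        0 < \det (\matrix_(a < #|S|, b < #|S|)
                    A (enum_val (A := S) a) (enum_val (A := S) b))].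

Definition dynkin_adj : rel 'I_n := fun i j => (i != j) && (A i j != 0).
Definition dynkin_connected : Prop := forall i j, connect dynkin_adj i j.

(* simple reflection s_i acting on weights (column vectors of coordinates
   in the basis of fundamental weights): s_i v = v - v_i alpha_i *)
Definition sref (i : 'I_n) : 'M[int]_n :=
  \matrix_(k, j) ((k == j)%:R - (j == i)%:R * A i k).

Definition wprod (s : seq 'I_n) : 'M[int]_n := foldr (fun i M => sref i *m M) 1%:M s.

Definition inW (w : 'M[int]_n) : Prop := exists s, wprod s = w.
Definition inWJ (J : {set 'I_n}) (w : 'M[int]_n) : Prop :=
  exists s, all (fun i => i \in J) s /\ wprod s = w.

Definition lenle (u v : 'M[int]_n) : Prop :=
  forall s, wprod s = v -> exists t, wprod t = u /\ (size t <= size s)%N.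
Definition reduced (s : seq 'I_n) (w : 'M[int]_n) : Prop :=
  wprod s = w /\ forall t, wprod t = w -> (size s <= size t)%N.
Definition bruhat (u w : 'M[int]_n) : Prop :=
  exists s t, reduced s w /\ subseq t s /\ wprod t = u.

Definition in_coset (J : {set 'I_n}) (w x : 'M[int]_n) : Prop :=
  exists y, inWJ J y /\ x = w *m y.
Definition is_minrep (J : {set 'I_n}) (w m : 'M[int]_n) : Prop :=
  in_coset J w m /\ forall x, in_coset J w x -> lenle m x.
Definition is_maxrep (J : {set 'I_n}) (w m : 'M[int]_n) : Prop :=
  in_coset J w m /\ forall x, in_coset J w x -> lenle x m.

Definition minrep (J : {set 'I_n}) (w : 'M[int]_n) : 'M[int]_n :=
  epsilon (inhabits (1%:M : 'M[int]_n)) (is_minrep J w).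
Definition maxrep (J : {set 'I_n}) (w : 'M[int]_n) : 'M[int]_n :=
  epsilon (inhabits (1%:M : 'M[int]_n)) (is_maxrep J w).

(* w in W^J (minimal length representatives); W/W_J is identified with W^J,
   the coset w W_J being represented by minrep J w; the Bruhat order on W/W_J
   is the Bruhat order on W^J; pi_J is  w |-> minrep J w. *)
Definition inWup (J : {set 'I_n}) (w : 'M[int]_n) : Prop := inW w /\ is_minrep J w w.

Definition w0 : 'M[int]_n := maxrep [set: 'I_n] 1%:M.

(* For J1 \subset J2 and theta in W/W_J2: the minimal / maximal element of the
   fibre pi_J2^{-1}(theta) in W/W_J1 (Bruhat order). *)
Definition minpre (J1 J2 : {set 'I_n}) (th : 'M[int]_n) : 'M[int]_n :=
  epsilon (inhabits (1%:M : 'M[int]_n)) (fun ph =>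
    [/\ inWup J1 ph, minrep J2 ph = minrep J2 th &
        forall ps, inWup J1 ps -> minrep J2 ps = minrep J2 th -> bruhat ph ps]).
Definition maxpre (J1 J2 : {set 'I_n}) (th : 'M[int]_n) : 'M[int]_n :=
  epsilon (inhabits (1%:M : 'M[int]_n)) (fun ph =>
    [/\ inWup J1 ph, minrep J2 ph = minrep J2 th &
        forall ps, inWup J1 ps -> minrep J2 ps = minrep J2 th -> bruhat ps ph]).

(* Delta_{Q'} for Q' = B W_v B : simple roots whose reflection fixes v *)
Definition stabset (v : 'cV[int]_n) : {set 'I_n} := [set k | sref k *m v == v].

Section Main.
Variable m : nat.
Variable lam : 'I_m -> 'cV[int]_n.
Variable Icol : {set {set 'I_m}}.

Definition dominant : Prop := forall i k, 0 <= lam i k 0.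

Definition covers (K J : {set 'I_m}) : bool :=
  [&& K \in Icol, J \in Icol, K \proper J &
      [forall L in Icol, ~~ ((K \proper L) && (L \proper J))]].

Definition ubar (J : {set 'I_m}) : {set 'I_m} :=
  if [exists K in Icol, K \proper J]
  then \bigcup_(K in Icol | covers K J) (J :\: K)
  else J.

Definition ichain (C : {set {set 'I_m}}) : Prop :=
  C \subset Icol /\ forall I J, I \in C -> J \in C -> (I \subset J) || (J \subset I).
Definition graded : Prop :=
  forall C, ichain C -> (forall C', ichain C' -> C \subset C' -> C' = C) -> #|C| = m.

Definition Icol_hyp : Prop :=
  [/\ forall I, I \in Icol -> I != set0,
      graded,
      [set: 'I_m] \in Icol
    & forall I J, I \in Icol -> J \in Icol -> ubar J \subset I -> J \subset I].

Definition lamI (I : {set 'I_m}) : 'cV[int]_n := \sum_(i in ubar I) lam i.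
Definition DP (I : {set 'I_m}) : {set 'I_n} := stabset (lamI I).
Definition DQ : {set 'I_n} := stabset (\sum_i lam i).
Definition DQI (I : {set 'I_m}) : {set 'I_n} := \bigcap_(J in Icol | J \subset I) DP J.

Definition Elt := ('M[int]_n * {set 'I_m})%type.
Definition elt0 : Elt := (1%:M, set0).

Section Tau.
Variable tau : 'M[int]_n.   (* element of W^Q representing tau *)

Definition inWl (x : Elt) : Prop := [/\ inWup DQ x.1, bruhat x.1 tau & x.2 \in Icol].
Definition leW (x y : Elt) : Prop := bruhat x.1 y.1 /\ x.2 \subset y.2.
Definition inWbar (x : Elt) : Prop :=
  [/\ inWup (DP x.2) x.1, bruhat x.1 (minrep (DP x.2) tau) & x.2 \in Icol].
Definition basebar (x y : Elt) : Prop :=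
  [/\ inWbar x, inWbar y, y.2 \subset x.2 &
      bruhat (minpre DQ (DP y.2) y.1) (maxpre DQ (DP x.2) x.1)].
Definition gebar : Elt -> Elt -> Prop := Relation_Operators.clos_trans Elt basebar.

Definition sdec (ge : Elt -> Elt -> Prop) (s : seq Elt) : Prop :=
  forall i j, (i < j < size s)%N ->
    ge (nth elt0 s i) (nth elt0 s j) /\ nth elt0 s i <> nth elt0 s j.

Definition barchain (C : seq Elt) : Prop := (forall x, x \in C -> inWbar x) /\ sdec gebar C.

Definition defchain (C D : seq Elt) : Prop :=
  [/\ size D = size C,
      forall x, x \in D -> inWl x,
      sdec (fun x y => leW y x) D
    & forall k, (k < size C)%N ->
        (nth elt0 D k).2 = (nth elt0 C k).2 /\
        minrep (DP (nth elt0 C k).2) (nth elt0 D k).1 = (nth elt0 C k).1].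

Definition tstd_chain (C : seq Elt) : Prop := barchain C /\ exists D, defchain C D.
Definition max_tstd_chain (C : seq Elt) : Prop :=
  tstd_chain C /\ forall C', tstd_chain C' -> {subset C <= C'} -> {subset C' <= C}.

Definition inD (x : Elt) : Prop :=
  exists C D, [/\ max_tstd_chain C, defchain C D & x \in D].
Definition geD (x y : Elt) : Prop :=
  leW y x /\ exists C D, [/\ max_tstd_chain C, defchain C D, x \in D & y \in D].

Definition rho (x : Elt) : Elt := (minrep (DP x.2) x.1, x.2).

Definition tau_standard : Prop :=
  [/\ forall x y, inD x -> inD y -> rho x = rho y -> x = y,
      forall z, inWbar z -> exists x, inD x /\ rho x = z
    & forall x y, inD x -> inD y -> (geD x y <-> gebar (rho x) (rho y))].

End Tau.

Definition cover_chain (I : {set 'I_m}) (c : seq {set 'I_m}) : bool :=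
  [&& I \in Icol, path covers I c & last I c == [set: 'I_m]].
Definition DQr (I : {set 'I_m}) (c : seq {set 'I_m}) : {set 'I_n} :=
  \bigcap_(J <- I :: c) DP J.

End Main.
End Weyl.

(* Main.v *)
Require Import Defs.
From HB Require Import structures.
From mathcomp Require Import all_boot all_order all_algebra.
From mathcomp Require Import fingroup perm boolp ring lra zify.
From Stdlib Require Import ClassicalEpsilon.
From Stdlib Require Relation_Operators.

(** W is a Coxeter group as soon as each root g alpha_i is positive or negative. If
    c = c+ - c- were a root with both parts nonzero, then, in the form normalized by (c, c) = 2,
    both (c+, c+) and (c-, c-) would be even and positive, and - (c+, c-) nonnegative, so that
    (c, c) >= 4.

    For an index set I and a cover chain c put P = P_I, X = Q_I, Y = Q^r, so that X and Y are
    contained in P and meet in Q, and let v be the longest element of W_P /\ W^X. Conditions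
    (ii), (iii) and (iv) all say that v lies in W_Y. The element (1, I) has a lift forced into
    v W_X (by the chain of the cosets of w_P below it) and a lift forced into W_Y (by the chain
    of the cosets of 1 above it), so uniqueness of the lift gives v in W_Y. Conversely, if
    v in W_Y always holds, (theta, I) |-> (theta v, I) identifies the poset of the pairs
    (theta W_P, I) with a subposet of W(lambda, tau), and in every maximal standard chain the
    lifts are pushed up to theta v W_X from below and down to theta W_Y from above, hence equal
    theta v. *)

Set Implicit Arguments.
Unset Strict Implicit.
Unset Printing Implicit Defensive.

(** * Coxeter systems given by a sign function on roots *)

Section CoxeterSystems.
Local Open Scope group_scope.

(** The argument closes up because X and Y meet exactly in Q: I accounts for the weights indexed by
    I, and each cover in c for the indices it adds. An element of W^Q is therefore determined by its
    cosets modulo W_X and modulo W_Y, and these are reached separately, the first through the part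
    of a chain below the given element, the second through the part above it. Uniqueness of the lift
    lets constraints from two different chains fall on one element. In the converse direction the
    obstacle is that the order on the cosets is only a transitive closure. Once v always lies in
    W_Y, it lies in W_{P_J} for every J containing I, and multiplication by v turns the generating
    relation into a Bruhat comparison. This relation is then already transitive, every chain has a
    defining chain, and maximal standard chains are saturated: each step either keeps the index set
    and lowers the length by one, or passes to a covered index set. Since tau is the class of w_0,
    the bound by tau never obstructs a lift. *)

Definition wordprod (G : groupType) (n : nat) (s : 'I_n -> G) (w : seq 'I_n) : G :=
  foldr (fun i g => s i * g) 1 w.

(* [pos g i] stands for g alpha_i > 0; [posL] says that alpha_j is the only positive root
   made negative by s_j. *)
Record coxSys (n : nat) := CoxSys {
  csG :> groupType;
  sg : 'I_n -> csG;
  pos : csG -> 'I_n -> bool;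
  sg2 : forall i, sg i * sg i = 1;
  sg_inj : injective sg;
  pos1 : forall i, pos 1 i;
  posS : forall g i, pos (g * sg i) i = ~~ pos g i;
  posL : forall g i j, pos g i -> ~~ pos (sg j * g) i -> sg j * g = g * sg i;
  word_bound : exists N, forall g, exists2 w, size w <= N & wordprod sg w = g }.

End CoxeterSystems.

Arguments pos {n c}.
Arguments sg {n c}.

Section Coxeter.
Local Open Scope group_scope.
Variables (n : nat) (W : coxSys n).
Implicit Types (g h u v x y z : W) (i j : 'I_n) (w r t : seq 'I_n) (J K : {set 'I_n}).

(* Locked, so that rewriting with [mulgA] does not unfold a word. *)
Fact wp_key : unit. Proof. exact: tt. Qed.
Definition wp w : W := locked_with wp_key (wordprod sg w).

Lemma wpE w : wp w = wordprod sg w. Proof. by rewrite /wp unlock. Qed.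

Lemma wp_nil : wp [::] = 1. Proof. by rewrite wpE. Qed.

Lemma wp_cons i w : wp (i :: w) = sg i * wp w. Proof. by rewrite !wpE. Qed.

Lemma wp_cat w r : wp (w ++ r) = wp w * wp r.
Proof. by elim: w => [|i w IH]; rewrite ?wp_nil ?mul1g //= !wp_cons IH mulgA. Qed.

Lemma wp1 i : wp [:: i] = sg i. Proof. by rewrite wp_cons wp_nil mulg1. Qed.

Lemma wp_rcons w i : wp (rcons w i) = wp w * sg i.
Proof. by rewrite -cats1 wp_cat wp1. Qed.

Lemma sgV i : (sg i : W)^-1 = sg i.
Proof. by apply/esym/eqP; rewrite eq_sym -(inj_eq (mulgI (sg i))) mulgV sg2. Qed.

Lemma sgK g i : g * sg i * sg i = g.
Proof. by rewrite -mulgA sg2 mulg1. Qed.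

Lemma sgKl g i : sg i * (sg i * g) = g.
Proof. by rewrite mulgA sg2 mul1g. Qed.

Lemma wp_rev w : wp (rev w) = (wp w)^-1.
Proof.
elim: w => [|i w IH]; first by rewrite wp_nil invg1.
by rewrite rev_cons wp_rcons wp_cons invgM IH sgV.
Qed.

(** * Length and the exchange property *)

Lemma ex_len g : exists k, `[< exists2 w, size w = k & wp w = g >].
Proof.
have [N /(_ g)[w _ ww]] := word_bound W.
by exists (size w); apply/asboolP; exists w; rewrite // wpE.
Qed.

Definition len g := ex_minn (ex_len g).

Lemma lenP g : exists2 w, size w = len g & wp w = g.
Proof. by rewrite /len; case: ex_minnP => k /asboolP. Qed.

Lemma len_le w : len (wp w) <= size w.
Proof. by rewrite /len; case: ex_minnP => k _; apply; apply/asboolP; exists w. Qed.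

Lemma len_bound : exists N, forall g, len g <= N.
Proof.
have [N hN] := word_bound W; exists N => g.
have [w sw <-] := hN g; rewrite -wpE; exact: leq_trans (len_le w) sw.
Qed.

Lemma len1 : len 1 = 0.
Proof. by apply/eqP; rewrite -leqn0 -wp_nil (len_le [::]). Qed.

Lemma len_eq0 g : len g = 0 -> g = 1.
Proof. by move=> g0; have [w] := lenP g; rewrite g0 => /size0nil ->; rewrite wp_nil. Qed.

Lemma lenV g : len g^-1 = len g.
Proof.
have le h : len h^-1 <= len h.
  by have [w <- <-] := lenP h; rewrite -wp_rev -(size_rev w) len_le.
by apply/eqP; rewrite eqn_leq le -{1}(invgK g) le.
Qed.

(** When the letters are applied from the right, the root g alpha_i turns negative at some letter
    s_j. By [posL] that letter passes through as s_i and cancels the s_i inserted by the reflection,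
    so it disappears from the word. *)
Lemma exchange w g i : pos g i -> ~~ pos (wp w * g) i ->
  exists w1 j w2, w = w1 ++ j :: w2 /\ wp w * (g * sg i * g^-1) = wp (w1 ++ w2).
Proof.
move=> pg; elim: w => [|j w IH] /=; first by rewrite wp_nil mul1g pg.
rewrite wp_cons; case: (boolP (pos (wp w * g) i)) => [pw|/IH].
  rewrite -mulgA => npw; exists [::], j, w; split=> //=.
  by rewrite !mulgA -(mulgA (sg j)) (posL pw npw) sgK mulgK.
case=> w1 [k [w2 [-> E]]] _; exists (j :: w1), k, w2; split=> //=.
by rewrite wp_cons -mulgA E.
Qed.

Definition reflection x := exists g i, x = g * sg i * g^-1.

Lemma reflection2 x : reflection x -> x * x = 1.
Proof. by move=> [g [i ->]]; rewrite -!mulgA mulKg (mulgA (sg i)) sg2 mul1g mulgV. Qed.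

Lemma reflection_sg i : reflection (sg i).
Proof. by exists 1, i; rewrite mul1g invg1 mulg1. Qed.

Lemma reflectionJ x i : reflection x -> reflection (sg i * x * sg i).
Proof. by move=> [g [j ->]]; exists (sg i * g), j; rewrite invgM sgV !mulgA. Qed.

Lemma reflection_pos x : reflection x -> exists g i, pos g i /\ x = g * sg i * g^-1.
Proof.
move=> [g [i ->]]; case: (boolP (pos g i)) => [pg|npg]; first by exists g, i.
exists (g * sg i), i; split; first by rewrite posS.
by rewrite sgK invgM sgV mulgA.
Qed.

(** The sign of w g alpha_i decides: if it is negative, exchange in a reduced word of w shows that w
    x is shorter; if it is positive, w x makes the root negative and the same applies with w and w x
    interchanged. *)
Lemma reflection_len x w : reflection x -> len (wp w * x) < len (wp w) \/ len (wp w) < len (wp w * x).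
Proof.
move=> /reflection_pos[g [i [pg ->]]].
have key w' : ~~ pos (wp w' * g) i -> len (wp w' * (g * sg i * g^-1)) < len (wp w').
  have [r rl rE] := lenP (wp w'); rewrite -rE => npg.
  have [w1 [j [w2 [E ->]]]] := exchange pg npg.
  rewrite rE -rl E; apply: leq_ltn_trans (len_le _) _.
  by rewrite !size_cat /= addnS.
case: (boolP (pos (wp w * g) i)) => [pw|npw]; last by left; apply: key.
right; have [r _ rE] := lenP (wp w * (g * sg i * g^-1)).
have := key r; rewrite rE.
have -> : wp w * (g * sg i * g^-1) * (g * sg i * g^-1) = wp w.
  by rewrite -mulgA reflection2 ?mulg1 //; exists g, i.
by apply; rewrite !mulgA mulgVK posS negbK.
Qed.

(** If w g alpha_i were positive, w x would make g alpha_i negative, and exchange in a reduced word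
    of w x would write w with one letter fewer, against the assumed drop in length. *)
Lemma strong_exchange x w : reflection x -> len (wp w * x) < len (wp w) ->
  exists w1 j w2, w = w1 ++ j :: w2 /\ wp w * x = wp (w1 ++ w2).
Proof.
move=> /reflection_pos[g [i [pg ->]]] lt; apply: exchange => //.
apply/negP => pw.
have [r _ rE] := lenP (wp w * (g * sg i * g^-1)).
have npr : ~~ pos (wp r * g) i by rewrite rE !mulgA mulgVK posS negbK.
have [w1 [j [w2 [E1 E2]]]] := exchange pg npr.
have [r' r'l r'E] := lenP (wp w * (g * sg i * g^-1)).
have npr' : ~~ pos (wp r' * g) i by rewrite r'E -rE.
have [w1' [j' [w2' [E1' E2']]]] := exchange pg npr'.
move: lt; rewrite -r'l E1' size_cat /= addnS ltnNge => /negP; apply.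
have <- : wp (w1' ++ w2') = wp w.
  by rewrite -E2' r'E -mulgA reflection2 ?mulg1 //; exists g, i.
by apply: leq_trans (len_le _) _; rewrite size_cat -addnS leq_add2l leqW.
Qed.

Lemma len_sg_le g i : len (g * sg i) <= (len g).+1.
Proof.
have [w <- <-] := lenP g; rewrite -wp_rcons -(size_rcons w i); exact: len_le.
Qed.

Lemma len_neg g i : ~~ pos g i -> len g = (len (g * sg i)).+1.
Proof.
move=> npg; apply/eqP; rewrite eqn_leq -{1}(sgK g i) len_sg_le /=.
have [w wl wE] := lenP g.
have [||w1 [j [w2 [E E2]]]] := @exchange w 1 i; rewrite ?pos1 ?mulg1 ?wE //.
move: E2; rewrite mul1g invg1 mulg1 wE => ->; rewrite -wl E size_cat /= addnS ltnS -size_cat.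
exact: len_le.
Qed.

Lemma len_pos g i : pos g i -> len (g * sg i) = (len g).+1.
Proof. by move=> pg; rewrite (@len_neg (g * sg i) i) ?sgK // posS pg. Qed.

Lemma posE g i : pos g i = (len g < len (g * sg i)).
Proof.
case: (boolP (pos g i)) => [/len_pos ->|/len_neg ->]; first by rewrite ltnSn.
by rewrite ltnNge leqW.
Qed.

Lemma len_sg i : len (sg i) = 1%N.
Proof. by rewrite -(mul1g (sg i)) len_pos ?pos1 // len1. Qed.

(** * Bruhat order *)

Inductive ble u : W -> Prop :=
| ble_refl : ble u u
| ble_step v x : ble u v -> reflection x -> len v < len (v * x) -> ble u (v * x).

Hint Resolve ble_refl : core.

Lemma ble_trans v u z : ble u v -> ble v z -> ble u z.
Proof. by move=> uv; elim=> // {}z x _ IH rx lt; apply: ble_step. Qed.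

Lemma ble_len u v : ble u v -> len u <= len v.
Proof. by elim=> // {}v x _ IH _ lt; apply: leq_trans IH (ltnW lt). Qed.

Lemma ble_eq u v : ble u v -> len v <= len u -> u = v.
Proof.
case=> // {}v x uv _ lt le.
by have := leq_ltn_trans (ble_len uv) (leq_trans lt le); rewrite ltnn.
Qed.

Lemma ble_anti u v : ble u v -> ble v u -> u = v.
Proof. by move=> uv /ble_len; apply: ble_eq. Qed.

Lemma ble_sg u i : pos u i -> ble u (u * sg i).
Proof. by rewrite posE => lt; apply: ble_step => //; exact: reflection_sg. Qed.

Lemma ble_sgN u i : ~~ pos u i -> ble (u * sg i) u.
Proof. by move=> npu; rewrite -{2}(sgK u i); apply: ble_sg; rewrite posS. Qed.

(* Humphreys, Reflection groups and Coxeter groups, 5.9. *)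
Lemma ble_mul_sg u v i : ble u v -> ble (u * sg i) v \/ ble (u * sg i) (v * sg i).
Proof.
elim=> [|{}v x uv [IH|IH] rx lt]; first by right.
  by left; apply: ble_step.
suff [H|H] : ble (v * sg i) (v * x) \/ ble (v * sg i) (v * x * sg i).
- by left; apply: ble_trans IH _.
- by right; apply: ble_trans IH _.
have [->|ne] := eqVneq x (sg i); first by left.
case: (boolP (pos v i)) => pv; last first.
  by left; apply: ble_step => //; exact: ble_sgN.
right; have E : v * sg i * (sg i * x * sg i) = v * x * sg i.
  by rewrite !mulgA sgK.
rewrite -E; have rx' := reflectionJ i rx.
have [r rl rE] := lenP v.
have Er : wp (rcons r i) = v * sg i by rewrite wp_rcons rE.
have [] := reflection_len (rcons r i) rx'; rewrite Er => lt'; last exact: ble_step.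
have [|w1 [j [w2 [E1 E2]]]] := @strong_exchange _ (rcons r i) rx'; first by rewrite Er.
move: E2; rewrite Er E.
case/lastP: w2 E1 => [|w2 k].
  rewrite cats0 cats1 => /rcons_inj[<- _]; rewrite rE => E2.
  by case/negP: ne; rewrite -(inj_eq (mulgI v)) -{2}E2 sgK.
rewrite -rcons_cons -rcons_cat => /rcons_inj[Er1 <-].
rewrite -rcons_cat wp_rcons => /mulIg E2.
move: lt; rewrite E2 -rl Er1 size_cat /= addnS => lt.
have := leq_trans lt (len_le (w1 ++ w2)).
by rewrite size_cat ltnNge leqnSn.
Qed.

(** The word of v may be any word: each reflection on the way down from v to u deletes one letter by
    [strong_exchange]. *)
Lemma ble_subword u v w : ble u v -> wp w = v -> exists2 t, subseq t w & wp t = u.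
Proof.
move=> uv; elim: uv w => [|{}v x uv IH rx lt] w wE; first by exists w.
have Ev : wp w * x = v by rewrite wE -mulgA reflection2 ?mulg1.
have [|w1 [j [w2 [E1 E2]]]] := @strong_exchange x w rx; first by rewrite Ev wE.
have [|t st tE] := IH (w1 ++ w2); first by rewrite -E2.
exists t => //; apply: subseq_trans st _; rewrite E1.
by apply: cat_subseq => //; exact: subseq_cons.
Qed.

Definition reducedw w := size w == len (wp w).

Lemma reduced_rcons w i : reducedw (rcons w i) -> reducedw w /\ pos (wp w) i.
Proof.
rewrite /reducedw size_rcons wp_rcons => /eqP E.
have le1 := len_le w.
case: (boolP (pos (wp w) i)) => pw.
  by move: E; rewrite len_pos // => -[->].
by move: le1; rewrite (len_neg pw) -E => /ltnW; rewrite ltnn.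
Qed.

Lemma subseq_rconsP (T : eqType) (x : T) (t w : seq T) :
  subseq t (rcons w x) -> subseq t w \/ exists2 t', subseq t' w & t = rcons t' x.
Proof.
rewrite -subseq_rev rev_rcons; case/lastP: t => [|t y]; first by left; exact: sub0seq.
rewrite rev_rcons /=; case: eqVneq => [->|_] /=.
  by rewrite subseq_rev => ?; right; exists t.
by rewrite -rev_rcons subseq_rev; left.
Qed.

Lemma subword_ble w t : reducedw w -> subseq t w -> ble (wp t) (wp w).
Proof.
elim/last_ind: w t => [|w i IH] t; first by move=> _; rewrite subseq0 => /eqP ->.
move=> /reduced_rcons[rw pw] /subseq_rconsP[st|[t' st ->]].
  by rewrite wp_rcons; apply: ble_trans (IH _ rw st) (ble_sg pw).
rewrite !wp_rcons; have [H|//] := ble_mul_sg i (IH _ rw st).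
exact: ble_trans H (ble_sg pw).
Qed.

Lemma reduced_ex g : exists2 w, reducedw w & wp w = g.
Proof. by have [w wl wE] := lenP g; exists w; rewrite // /reducedw wE wl. Qed.

(** The subword description is the form used by [bruhat]; [ble] is generated by reflections because
    transitivity is then immediate. *)
Lemma bleP u v : ble u v <-> exists w t, [/\ reducedw w, wp w = v, subseq t w & wp t = u].
Proof.
split=> [uv|[w [t [rw <- st <-]]]]; last exact: subword_ble.
have [w rw wE] := reduced_ex v; have [t st tE] := ble_subword uv wE.
by exists w, t.
Qed.

Lemma reduced_rev w : reducedw w -> reducedw (rev w).
Proof. by rewrite /reducedw size_rev wp_rev lenV. Qed.

Lemma bleV u v : ble u v -> ble u^-1 v^-1.
Proof.
move=> /bleP[w [t [rw <- st <-]]]; rewrite -!wp_rev.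
by apply: subword_ble; rewrite ?reduced_rev // subseq_rev.
Qed.

Lemma ble1 v : ble 1 v.
Proof. by apply/bleP; have [w] := reduced_ex v; exists w, [::]; rewrite sub0seq wp_nil. Qed.

(** The lifting property at a right descent s_i of v, in three forms; [ble_lift1l] to [ble_lift3l]
    are their mirror images under inversion. *)
Lemma ble_lift1 u v i : ~~ pos v i -> ble u v -> ble (u * sg i) v.
Proof.
by move=> npv /(ble_mul_sg i)[//|H]; apply: ble_trans H (ble_sgN npv).
Qed.

Lemma ble_lift2 u v i : ~~ pos v i -> pos u i -> ble u v -> ble u (v * sg i).
Proof.
move=> npv pu uv; have [r rr rE] := reduced_ex (v * sg i).
have wE : wp (rcons r i) = v by rewrite wp_rcons rE sgK.
have [t /subseq_rconsP[st|[t' st ->]] tE] := ble_subword uv wE.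
  by rewrite -rE -tE; apply: subword_ble.
move: tE; rewrite wp_rcons => tE; have Et : wp t' = u * sg i by rewrite -tE sgK.
apply: ble_trans (ble_sg pu) _; rewrite -Et -rE; exact: subword_ble.
Qed.

Lemma ble_lift3 u v i : ~~ pos v i -> ~~ pos u i -> ble u v -> ble (u * sg i) (v * sg i).
Proof.
move=> npv npu uv; apply: ble_lift2 => //; first by rewrite posS.
exact: ble_trans (ble_sgN npu) uv.
Qed.

Lemma ble_catl u v : len (u * v) = len u + len v -> ble u (u * v) /\ ble v (u * v).
Proof.
have [r /eqP rl <-] := reduced_ex u; have [t /eqP tl <-] := reduced_ex v.
rewrite -wp_cat => E; have rr : reducedw (r ++ t) by rewrite /reducedw E size_cat rl tl.
by split; apply: subword_ble rr _; rewrite ?prefix_subseq ?suffix_subseq.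
Qed.

Lemma reduced_sub w : exists t, [/\ subseq t w, reducedw t & wp t = wp w].
Proof.
elim/last_ind: w => [|w i [t [st rt tE]]].
  by exists [::]; split=> //; rewrite /reducedw wp_nil len1.
case: (boolP (pos (wp t) i)) => pt.
  exists (rcons t i); split; last by rewrite !wp_rcons tE.
    by rewrite -!cats1 cat_subseq.
  by rewrite /reducedw size_rcons wp_rcons len_pos // -(eqP rt).
have [||w1 [j [w2 [E E2]]]] := @exchange t 1 i; rewrite ?pos1 ?mulg1 //.
move: E2; rewrite mul1g invg1 mulg1 => E2.
exists (w1 ++ w2); split; last by rewrite wp_rcons -tE.
  apply: subseq_trans (subseq_rcons _ _); apply: subseq_trans st; rewrite E.
  by rewrite cat_subseq // subseq_cons.
have := len_neg pt; rewrite -(eqP rt) E2 E size_cat /= addnS => -[E3].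
by rewrite /reducedw -E3 size_cat.
Qed.

(** * Parabolic subgroups and minimal coset representatives *)

Definition inP J g := exists2 w, all [in J] w & wp w = g.

Lemma inP1 J : inP J 1. Proof. by exists [::]; rewrite ?wp_nil. Qed.
Hint Resolve inP1 : core.

Lemma inP_sgi J j : j \in J -> inP J (sg j).
Proof. by move=> jJ; exists [:: j]; rewrite ?wp1 //= jJ. Qed.

Lemma inPM J g h : inP J g -> inP J h -> inP J (g * h).
Proof. by move=> [w aw <-] [r ar <-]; exists (w ++ r); rewrite ?wp_cat // all_cat aw. Qed.

Lemma inPV J g : inP J g -> inP J g^-1.
Proof. by move=> [w aw <-]; exists (rev w); rewrite ?wp_rev ?all_rev. Qed.

Lemma inP_cosetC J g h : inP J (g^-1 * h) -> inP J (h^-1 * g).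
Proof. by move=> /inPV; rewrite invgM invgK. Qed.

Lemma inP_cosetT J g h k : inP J (g^-1 * h) -> inP J (h^-1 * k) -> inP J (g^-1 * k).
Proof. by move=> H1 H2; have := inPM H1 H2; rewrite -!mulgA mulVKg. Qed.

Lemma inP_mono J K g : J \subset K -> inP J g -> inP K g.
Proof. by move=> /subsetP JK [w aw <-]; exists w => //; apply: sub_all aw. Qed.

Lemma inP_reduced J g : inP J g -> exists w, [/\ all [in J] w, reducedw w & wp w = g].
Proof.
move=> [w aw <-]; have [t [st rt <-]] := reduced_sub w; exists t; split=> //.
by apply/allP => i /(mem_subseq st); apply: (allP aw).
Qed.

Lemma inP_ble J u v : inP J v -> ble u v -> inP J u.
Proof.
move=> [w aw wE] uv; have [t st <-] := ble_subword uv wE; exists t => //.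
by apply/allP => i /(mem_subseq st); apply: (allP aw).
Qed.

Lemma inP_sg J j : inP J (sg j) -> j \in J.
Proof.
move=> /inP_reduced[[|k [|l w]] []]; rewrite /reducedw ?wp1.
- by move=> _ _ E; have := len_sg j; rewrite -E wp_nil len1.
- by rewrite /= andbT => kJ _ /sg_inj <-.
by move=> _ /eqP + E; rewrite E len_sg.
Qed.

(** Each letter of a reduced word of g lies below g, and W_K is closed downwards, so a reduced word
    with letters in J has its letters in K as well. *)
Lemma inPI J K g : inP J g -> inP K g -> inP (J :&: K) g.
Proof.
move=> /inP_reduced[w [aw rw <-]] Kg; exists w => //; apply/allP => i iw.
rewrite inE (allP aw) //=; apply: inP_sg; apply: inP_ble Kg _.
by rewrite -wp1; apply: subword_ble; rewrite // sub1seq.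
Qed.

Definition isup J g := [forall j in J, pos g j].

Lemma isupP J g : reflect (forall j, j \in J -> pos g j) (isup J g).
Proof. exact: forall_inP. Qed.

Lemma isup_mono J K g : J \subset K -> isup K g -> isup J g.
Proof. by move=> /subsetP JK /isupP H; apply/isupP => j /JK /H. Qed.

Lemma isup1 J : isup J 1.
Proof. by apply/isupP => j _; rewrite pos1. Qed.

Lemma cat_eq_split (T : Type) (a : T) (r w w1 w2 : seq T) : r ++ w = w1 ++ a :: w2 ->
  (exists b, r = w1 ++ a :: b /\ w2 = b ++ w) \/ (exists b, w1 = r ++ b /\ w = b ++ a :: w2).
Proof.
elim: r w1 => [|k r IH] w1 /=; first by right; exists w1.
case: w1 => [[-> <-]|k' w1 [-> /IH]]; first by left; exists r.
by case=> -[b [-> ->]]; [left|right]; exists b.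
Qed.

Lemma ex_min_coset J g : exists2 v, inP J (g^-1 * v) &
  forall x, inP J x -> len v <= len (v * x).
Proof.
have ex : exists k, `[< exists2 v, inP J (g^-1 * v) & len v = k >].
  by exists (len g); apply/asboolP; exists g => //; rewrite mulVg.
case: (ex_minnP ex) => k /asboolP[v gv vk] kmin; exists v => // x Jx.
rewrite vk; apply: kmin; apply/asboolP; exists (v * x) => //.
by rewrite mulgA; apply: inPM.
Qed.

(** If appending s_i to v w lowered the length, exchange would delete a letter of v or one of w. The
    former contradicts the minimality of v in v W_J, the latter the reducedness of w s_i. *)
Lemma lenM_min J v x : (forall x, inP J x -> len v <= len (v * x)) -> inP J x ->
  len (v * x) = len v + len x.
Proof.
move=> vmin /inP_reduced[w [aw rw <-]].
elim/last_ind: w aw rw => [|w i IH]; first by rewrite wp_nil mulg1 len1 addn0.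
rewrite all_rcons => /andP[iJ aw] /reduced_rcons[rw pw].
have {}IH := IH aw rw; rewrite wp_rcons mulgA (len_pos pw) addnS -IH.
apply: len_pos; apply/negPn/negP => npw.
have [r rr rE] := reduced_ex v.
have [||w1 [j [w2 [E E2]]]] := @exchange (r ++ w) 1 i;
  rewrite ?pos1 ?mulg1 ?wp_cat ?rE //.
have wi_in : inP J (wp w * sg i) by apply: inPM; [exists w|exact: inP_sgi].
move: E2; rewrite mul1g invg1 mulg1 wp_cat rE.
have [[a [Er Ew]]|[a [Er Ew]]] := cat_eq_split E.
- move=> E2; have : len v <= size (w1 ++ a).
    have {}rv : wp (w1 ++ a) = v * (wp w * sg i * (wp w)^-1).
      by apply: (mulIg (wp w)); rewrite mulgA mulgVK mulgA -wp_cat -catA -Ew E2 wp_cat.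
    apply: leq_trans (len_le _); rewrite rv; apply: vmin.
    by apply: inPM wi_in (inPV _); exists w.
  by rewrite -rE -(eqP rr) Er !size_cat /= addnS ltnn.
rewrite Er Ew !wp_cat rE -!mulgA => /mulgI E2.
have : len (wp w * sg i) < (size w).+1.
  by rewrite Ew wp_cat -mulgA E2 -wp_cat (leq_ltn_trans (len_le _)) // !size_cat /= addnS ltnW.
by rewrite (len_pos pw) -(eqP rw) ltnn.
Qed.

(** Positivity on the simple roots of J suffices: write v = m x with m minimal; if x were not 1, the
    last letter of a reduced word of x would be a descent of v in J. *)
Lemma isup_min J v : isup J v <-> (forall x, inP J x -> len v <= len (v * x)).
Proof.
split=> [/isupP up|vmin]; last first.
  apply/isupP => j jJ; apply/negPn/negP => /len_neg lv.
  by have := vmin _ (inP_sgi jJ); rewrite lv ltnn.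
have [m Jm mmin] := ex_min_coset J v.
have Jx : inP J (m^-1 * v) by exact: inP_cosetC.
suff -> : v = m by [].
have [w [aw rw wE]] := inP_reduced Jx.
case/lastP: w aw rw wE => [|w i]; first by rewrite wp_nil => _ _ E; rewrite -(mulVKg m v) -E mulg1.
rewrite all_rcons => /andP[iJ aw] /reduced_rcons[_ pw]; rewrite wp_rcons => wE.
have E : v * sg i = m * wp w.
  by rewrite -(mulVKg m v) -wE mulgA sgK.
have Jw : inP J (wp w) by exists w.
have := up i iJ; rewrite posE E (lenM_min mmin Jw) -(mulVKg m v) (lenM_min mmin Jx).
by rewrite -wE (len_pos pw) ltn_add2l ltnNge leqnSn.
Qed.

Lemma lenM J v x : isup J v -> inP J x -> len (v * x) = len v + len x.
Proof. by move=> /isup_min; apply: lenM_min. Qed.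

Lemma ble_mulP J v x : isup J v -> inP J x -> ble v (v * x).
Proof. by move=> up Jx; have [] := ble_catl (lenM up Jx). Qed.

Lemma pos_mulP J v x j : isup J v -> inP J x -> j \in J -> pos (v * x) j = pos x j.
Proof.
move=> up Jx jJ; rewrite !posE -mulgA !(lenM up) ?ltn_add2l //.
by apply: inPM Jx (inP_sgi jJ).
Qed.

Lemma isup_uniq J u v : isup J u -> isup J v -> inP J (u^-1 * v) -> u = v.
Proof.
move=> uu uv Juv; apply: ble_anti; first by rewrite -(mulVKg u v); apply: ble_mulP uu _.
by rewrite -(mulVKg v u); apply: ble_mulP uv _; exact: inP_cosetC.
Qed.

Lemma mr_ex J g : exists v, inP J (g^-1 * v) /\ isup J v.
Proof. by have [v Jv /isup_min] := ex_min_coset J g; exists v. Qed.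

Definition mr J g : W := projT1 (cid (mr_ex J g)).

Lemma mr_in J g : inP J (g^-1 * mr J g).
Proof. by rewrite /mr; case: cid => v []. Qed.

Lemma mr_in' J g : inP J ((mr J g)^-1 * g).
Proof. exact: inP_cosetC (mr_in J g). Qed.

Lemma isup_mr J g : isup J (mr J g).
Proof. by rewrite /mr; case: cid => v []. Qed.
Hint Resolve mr_in mr_in' isup_mr : core.

Lemma mr_id J g : isup J g -> mr J g = g.
Proof. by move=> up; apply/esym; apply: isup_uniq up _ _. Qed.

Lemma mrP J g h : mr J g = mr J h <-> inP J (g^-1 * h).
Proof.
split=> [E|Jgh]; first by apply: inP_cosetT (mr_in J g) _; rewrite E.
apply: (@isup_uniq J) => //; apply: inP_cosetT (mr_in' J g) _.
exact: inP_cosetT Jgh (mr_in J h).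
Qed.

Lemma mr_inP J g x : inP J x -> mr J (g * x) = mr J g.
Proof. by move=> Jx; apply/mrP; rewrite invgM -mulgA mulVg mulg1; exact: inPV. Qed.

Lemma mr_mr J K g : J \subset K -> mr K (mr J g) = mr K g.
Proof. by move=> JK; apply/mrP; apply: inP_mono JK _. Qed.

(** This is how lifts are identified: modulo two parabolic subgroups separately, hence modulo their
    intersection. *)
Lemma mrI J K g h : mr J g = mr J h -> mr K g = mr K h -> mr (J :&: K) g = mr (J :&: K) h.
Proof. by move=> /mrP H1 /mrP H2; apply/mrP; apply: inPI. Qed.

Lemma mr_ble J g : ble (mr J g) g.
Proof. by rewrite -{2}(mulVKg (mr J g) g); apply: ble_mulP (isup_mr J g) _. Qed.

(** A descent s_j of v with j in J can be stripped from v; by lifting, u or u s_j, which have the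
    same projection, stays below. The induction ends when v is in W^J. *)
Lemma ble_mr J u v : ble u v -> ble (mr J u) (mr J v).
Proof.
elim: {v}(len v) {-2}v (leqnn (len v)) u => [|k IH] v lv u uv.
  have v1 : v = 1 by apply: len_eq0; apply/eqP; rewrite -leqn0.
  have -> : u = 1.
    by apply: len_eq0; apply/eqP; rewrite -leqn0 -len1 -v1 (ble_len uv).
  by rewrite v1; exact: ble_refl.
case: (boolP (isup J v)) => [upv|].
  by rewrite (mr_id upv); apply: ble_trans (mr_ble J u) uv.
rewrite negb_forall => /existsP[j]; rewrite negb_imply => /andP[jJ npv].
have Jj := inP_sgi jJ; rewrite -(mr_inP v Jj).
have lt : len (v * sg j) <= k by rewrite -ltnS -(len_neg npv).
case: (boolP (pos u j)) => pu; first by apply: IH => //; exact: ble_lift2.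
by rewrite -(mr_inP u Jj); apply: IH => //; exact: ble_lift3.
Qed.

Lemma isup_ble_mr J u v : isup J u -> ble u v -> ble u (mr J v).
Proof. by move=> /mr_id {2}<-; apply: ble_mr. Qed.

(** * Longest elements of cosets *)

Definition islong J z := [forall j in J, ~~ pos z j].

Lemma islongP J z : reflect (forall j, j \in J -> ~~ pos z j) (islong J z).
Proof. exact: forall_inP. Qed.

Lemma long_ble J u z x : islong J z -> ble u z -> inP J x -> ble (u * x) z.
Proof.
move=> /islongP lz uz [w + <-]; elim/last_ind: w => [|w i IH]; first by rewrite wp_nil mulg1.
rewrite all_rcons => /andP[iJ /IH H]; rewrite wp_rcons mulgA.
by apply: ble_lift1 H; apply: lz.
Qed.

Lemma wl_ex J : exists z, inP J z /\ islong J z.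
Proof.
have [N hN] := len_bound.
have ex : exists k, `[< exists2 z, inP J z & len z = k >].
  by exists 0; apply/asboolP; exists 1; rewrite ?len1.
have ub k : `[< exists2 z, inP J z & len z = k >] -> k <= N.
  by move=> /asboolP[z _ <-].
case: (ex_maxnP ex ub) => k /asboolP[z Jz zk] kmax; exists z; split=> //.
apply/islongP => j jJ; apply/negP => pz.
have := kmax (len (z * sg j)); rewrite (len_pos pz) zk ltnn => /(_ _)/negP; apply.
  by apply/asboolP; exists (z * sg j); rewrite ?(len_pos pz) ?zk //; apply: inPM Jz (inP_sgi jJ).
by [].
Qed.

Definition wl J : W := projT1 (cid (wl_ex J)).

Lemma wl_in J : inP J (wl J).
Proof. by rewrite /wl; case: cid => v []. Qed.

Lemma islong_wl J : islong J (wl J).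
Proof. by rewrite /wl; case: cid => v []. Qed.

Lemma ble_wl J x : inP J x -> ble x (wl J).
Proof.
by move=> Jx; rewrite -(mul1g x); apply: long_ble (islong_wl J) (ble1 _) Jx.
Qed.

Definition mx J g := mr J g * wl J.

Lemma mx_in J g : inP J (g^-1 * mx J g).
Proof. by rewrite mulgA; apply: inPM (mr_in J g) (wl_in J). Qed.
Hint Resolve mx_in : core.

Lemma mr_mx J g : mr J (mx J g) = mr J g.
Proof. by apply/esym/mrP. Qed.

Lemma islong_mx J g : islong J (mx J g).
Proof.
apply/islongP => j jJ; rewrite (pos_mulP (isup_mr J g) (wl_in J) jJ).
by have /islongP := islong_wl J; apply.
Qed.
Hint Resolve islong_mx : core.

Lemma mx_eq J g h : inP J (g^-1 * h) -> mx J g = mx J h.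
Proof. by move=> /mrP; rewrite /mx => ->. Qed.

Lemma ble_mx J g h : inP J (g^-1 * h) -> ble h (mx J g).
Proof.
move=> Jgh; rewrite -(mulVKg (mx J g) h); apply: long_ble (ble_refl _) _ => //.
by apply: inP_cosetT Jgh; apply: inP_cosetC.
Qed.

Lemma ble_mx_self J g : ble g (mx J g).
Proof. by apply: ble_mx; rewrite mulVg. Qed.

Lemma ble_top x : ble x (wl setT).
Proof.
apply: ble_wl; have [w _ <-] := reduced_ex x; exists w => //.
by apply/allP => i _; rewrite inE.
Qed.

Lemma isup_mulP J v x K : isup J v -> inP J x -> K \subset J -> isup K x -> isup K (v * x).
Proof.
move=> up Jx /subsetP KJ /isupP upx; apply/isupP => j jK.
by rewrite (pos_mulP up Jx) ?upx ?KJ.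
Qed.

Lemma ble_lift1l u v i : ~~ pos v^-1 i -> ble u v -> ble (sg i * u) v.
Proof.
move=> npv uv; have := bleV (ble_lift1 npv (bleV uv)).
by rewrite invgM !invgK sgV.
Qed.

Lemma ble_lift2l u v i : ~~ pos v^-1 i -> pos u^-1 i -> ble u v -> ble u (sg i * v).
Proof.
move=> npv pu uv; have := bleV (ble_lift2 npv pu (bleV uv)).
by rewrite invgM !invgK sgV.
Qed.

Lemma ble_lift3l u v i : ~~ pos v^-1 i -> ~~ pos u^-1 i -> ble u v -> ble (sg i * u) (sg i * v).
Proof.
move=> npv npu uv; have := bleV (ble_lift3 npv npu (bleV uv)).
by rewrite !invgM !invgK sgV.
Qed.

Lemma len_negl v i : ~~ pos v^-1 i -> len v = (len (sg i * v)).+1.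
Proof.
by move=> /len_neg; rewrite lenV -(lenV (_ * sg i)) invgM invgK sgV.
Qed.

Lemma len_posl v i : pos v^-1 i -> len (sg i * v) = (len v).+1.
Proof.
by move=> /len_pos; rewrite lenV -(lenV (_ * sg i)) invgM invgK sgV.
Qed.

Lemma posSl v i : pos (sg i * v)^-1 i = ~~ pos v^-1 i.
Proof. by rewrite invgM sgV posS. Qed.

(** If s_i v made alpha_j negative for some j in J, [posL] would give s_i v = v s_j, where the left
    side is shorter than v and the right side longer. *)
Lemma isup_negl J v i : isup J v -> ~~ pos v^-1 i -> isup J (sg i * v).
Proof.
move=> /isupP up npv; apply/isupP => j jJ; apply/negPn/negP => npj.
have := len_pos (up j jJ); rewrite -(posL (up j jJ) npj).
by have -> := len_negl npv => /eqP; rewrite ltn_eqF // ltnW.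
Qed.

(* Induction on v through a left descent s_i; Deodhar's lemma, that s_i z is in W^J or in z W_J
   when z is in W^J, is the case where the chain below s_i v cannot be lifted. *)
Lemma quotient_chain J u v : isup J u -> isup J v -> ble u v -> u <> v ->
  exists z, [/\ isup J z, ble u z, ble z v & len v = (len z).+1].
Proof.
elim: {v}(len v) {-2}v (leqnn (len v)) u => [|k IH] v lv u upu upv uv ne.
  case: ne; apply: ble_eq uv _; apply: leq_trans lv _; exact: leq0n.
have v1 : v <> 1.
  move=> v1; apply: ne; apply: ble_eq uv _; by rewrite v1 len1.
have [i npv] : exists i, ~~ pos v^-1 i.
  have [w rw wE] := reduced_ex v; case: w rw wE => [|i w rw wE].
    by rewrite wp_nil => _ /esym.
  exists i; rewrite posE -ltnNge ltnS -{1}(sgV i) -invgM !lenV -wE wp_cons sgKl.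
  by rewrite -wp_cons -(eqP rw) leqW // len_le.
have lsv : len (sg i * v) <= k by rewrite -ltnS -(len_negl npv).
have upsv := isup_negl upv npv.
have sv_v : ble (sg i * v) v by apply: ble_lift1l npv (ble_refl _).
have direct : ble u (sg i * v) -> exists z, [/\ isup J z, ble u z, ble z v & len v = (len z).+1].
  by move=> usv; exists (sg i * v); split=> //; exact: len_negl.
case: (boolP (pos u^-1 i)) => pu; first by apply: direct; exact: ble_lift2l.
have upsu := isup_negl upu pu.
have [||z [upz suz zsv lz]] := IH _ lsv (sg i * u) upsu upsv; first exact: ble_lift3l.
  by move/mulgI.
case: (boolP (pos z^-1 i)) => pz; last first.
  by apply: direct; rewrite -(sgKl u i); apply: ble_trans (ble_lift1l pz suz) zsv.
have pz' : ~~ pos (sg i * z)^-1 i by rewrite posSl pz.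
have z_sz : ble z (sg i * z) by rewrite -{1}(sgKl z i); apply: ble_lift1l pz' (ble_refl _).
have usz : ble u (sg i * z).
  by rewrite -(sgKl u i); apply: ble_lift1l pz' _; apply: ble_trans suz z_sz.
case: (boolP (isup J (sg i * z))) => [upsz|].
  exists (sg i * z); split=> //; last by rewrite (len_negl npv) lz (len_posl pz).
  by apply: ble_lift1l npv _; apply: ble_trans zsv sv_v.
(* Here s_i z = z s_j with j in J, so projecting to W^J gives u <= z, and s_i v itself is the
   required element. *)
rewrite negb_forall => /existsP[j]; rewrite negb_imply => /andP[jJ npj].
apply: direct; apply: ble_trans zsv.
move: usz; rewrite (posL (isupP _ _ upz j jJ) npj) => usz.
by have := ble_mr J usz; rewrite (mr_id upu) (mr_inP _ (inP_sgi jJ)) (mr_id upz).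
Qed.

End Coxeter.

Import Order.TTheory GRing.Theory Num.Theory.
Local Open Scope ring_scope.

(** * Finite type Cartan matrices *)

Lemma det_mxsub_perm (R : comRingType) n (M : 'M[R]_n) k k' (h : 'I_k' -> 'I_n) (p : 'I_k -> 'I_k') :
  k = k' -> injective p -> \det (mxsub (h \o p) (h \o p) M) = \det (mxsub h h M).
Proof.
move=> E; subst k' => pinj; set s := perm pinj.
have -> : mxsub (h \o p) (h \o p) M = row_perm s (col_perm s (mxsub h h M)).
  by apply/matrixP => i j; rewrite !mxE /= !permE.
rewrite row_permE col_permE !det_mulmx !det_perm odd_permV mulrCA.
by rewrite -signr_addb addbb mulr1.
Qed.

(** The Schur complement induction selects rows by arbitrary injections, not by subsets in their
    enumeration order. Rows and columns are permuted together, so the two signs cancel. *)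
Lemma minors_of_set_minors n (A : 'M[int]_n) :
  (forall S : {set 'I_n}, S != set0 ->
     0 < \det (\matrix_(a < #|S|, b < #|S|) A (enum_val (A := S) a) (enum_val (A := S) b))) ->
  forall k (f : 'I_k -> 'I_n), injective f -> 0 < \det (mxsub f f A).
Proof.
move=> H [|k] f finj; first by rewrite det_mx00.
pose S := f @: [set: 'I_k.+1].
have fS i : f i \in S by apply: imset_f; rewrite inE.
have cS : k.+1 = #|S| by rewrite card_imset // cardsT card_ord.
pose p i := enum_rank_in (fS ord0) (f i).
have pE i : enum_val (p i) = f i by rewrite enum_rankK_in.
have pinj : injective p by move=> i j /(congr1 enum_val); rewrite !pE; apply: finj.
have -> : mxsub f f A = mxsub (@enum_val _ (mem S) \o p) (@enum_val _ (mem S) \o p) A.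
  by apply/matrixP => i j; rewrite !mxE /= !pE.
rewrite det_mxsub_perm //.
have -> : mxsub (@enum_val _ (mem S)) (@enum_val _ (mem S)) A =
  \matrix_(a < #|S|, b < #|S|) A (enum_val (A := S) a) (enum_val (A := S) b).
  by apply/matrixP => i j; rewrite !mxE.
by apply: H; apply/set0Pn; exists (f ord0).
Qed.

(* A matrix with nonpositive off-diagonal entries and positive principal minors is an M-matrix;
   the induction passes to the Schur complement of the first entry. *)
Lemma mmatrix_pos_vec (F : realFieldType) n (M : 'M[F]_n) :
  (forall i j, i != j -> M i j <= 0) ->
  (forall k (f : 'I_k -> 'I_n), injective f -> 0 < \det (mxsub f f M)) ->
  exists u : 'I_n -> F, (forall i, 0 < u i) /\ (forall i, 0 < \sum_j M i j * u j).
Proof.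
elim: n M => [|n IH] M Mle Mdet; first by exists (fun=> 1); split; case.
pose z : 'I_(1 + n) := lshift n ord0.
pose l (i : 'I_n) : 'I_(1 + n) := rshift 1 i.
pose a := M z z.
have a0 : 0 < a.
  have := Mdet 1%N (fun=> z) _; rewrite (mx11_scalar (mxsub _ _ _)) det_scalar1 mxE; apply.
  by move=> i j _; rewrite !ord1.
have zl i : z != l i by rewrite eq_lrshift.
have ll i j : i != j -> l i != l j by rewrite (inj_eq (@rshift_inj _ _)).
pose S := \matrix_(i, j) (M (l i) (l j) - M (l i) z * M z (l j) / a).
have [||u [u0 Su]] := IH S.
- move=> i j ij; rewrite mxE subr_le0; apply: le_trans (Mle _ _ (ll _ _ ij)) _.
  apply: divr_ge0 (ltW a0); apply: mulr_le0; apply: Mle; last exact: zl.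
  by rewrite eq_sym; exact: zl.
- move=> k f finj.
  pose g (x : 'I_(1 + k)) := match split x with inl _ => z | inr j => l (f j) end.
  have gl i : g (lshift k i) = z by rewrite /g (unsplitK (inl i)).
  have gr i : g (rshift 1 i) = l (f i) by rewrite /g (unsplitK (inr i)).
  have ginj : injective g.
    move=> x y; rewrite -[x]splitK -[y]splitK.
    case: (split x) (split y) => [i|i] [j|j] /=; rewrite ?gl ?gr ?ord1 //.
    by move/rshift_inj/finj ->.
  have := Mdet _ g ginj.
  set N := mxsub g g M.
  pose c : 'M[F]_(k, 1) := \col_i (- (M (l (f i)) z / a)).
  (* Row elimination with pivot a: the minor of M on the pivot and f is a times the minor of S on
     f. *)
  have E : block_mx 1%:M 0 c 1%:M *m N =
      block_mx (a%:M : 'M_1) (\row_j M z (l (f j))) 0 (mxsub f f S).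
    rewrite -[N]submxK mulmx_block !mul1mx !mul0mx !addr0; congr block_mx.
    + by apply/matrixP => i j; rewrite !mxE !gl !ord1 eqxx mulr1n.
    + by apply/matrixP => i j; rewrite !mxE gl gr.
    + apply/matrixP => i j; rewrite !mxE big_ord1 !mxE !gl gr -/a.
      by rewrite mulNr divfK ?gt_eqF // addNr.
    + apply/matrixP => i j; rewrite !mxE big_ord1 !mxE !gl !gr addrC.
      by congr (_ + _); rewrite mulNr mulrAC.
  have := congr1 determinant E.
  rewrite det_mulmx det_lblock !det1 !mul1r => ->.
  by rewrite det_ublock det_scalar1 pmulr_rgt0.
pose si i := \sum_j S i j * u j.
(* The inverse of 1 plus the sum of all ratios - M_iz / s_i, so that - M_iz dl < s_i holds for every
   i at once. *)
pose dl := (1 + \sum_i - M (l i) z / si i)^-1.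
have term i : 0 <= - M (l i) z / si i.
  by rewrite divr_ge0 ?(ltW (Su i)) // oppr_ge0 Mle // eq_sym.
have dl0 : 0 < dl by rewrite invr_gt0 ltr_pwDl // sumr_ge0.
have dlS i : - M (l i) z * dl < si i.
  rewrite ltr_pdivrMr; last by rewrite ltr_pwDl // sumr_ge0.
  rewrite mulrC -ltr_pdivrMr ?Su // (bigD1 i) //=.
  have : 0 <= \sum_(k | k != i) - M (l k) z / si k by apply: sumr_ge0.
  by move: (- M (l i) z / si i) (\sum_(k | _) _) => x y y0; lra.
(* With this first coordinate, row z of M v equals a dl and row i equals s_i + M_iz dl. *)
pose t := dl - \sum_j M z (l j) * u j / a.
pose v (x : 'I_(1 + n)) := match split x with inl _ => t | inr j => u j end.
have vl i : v (lshift n i) = t by rewrite /v (unsplitK (inl i)).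
have vr i : v (rshift 1 i) = u i by rewrite /v (unsplitK (inr i)).
exists v; split=> x.
  rewrite -[x](@splitK 1 n); case: (@split 1 n x) => i; rewrite /= ?vl ?vr //.
  rewrite /t subr_gt0; apply: le_lt_trans dl0; apply: sumr_le0 => j _.
  by rewrite pmulr_lle0 ?invr_gt0 // pmulr_lle0 // Mle.
have rowE y : \sum_j M y j * v j = M y z * t + \sum_j M y (l j) * u j.
  rewrite (@big_split_ord _ _ _ 1 n) /= big_ord1 vl; congr (_ * _ + _).
  by apply: eq_bigr => j _; rewrite vr.
rewrite rowE -[x](@splitK 1 n); case: (@split 1 n x) => i /=.
  rewrite ord1 -/z -/a /t mulrBr mulr_sumr.
  under [X in _ - X]eq_bigr => j _ do rewrite mulrC divfK ?gt_eqF //.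
  by rewrite subrK mulr_gt0.
rewrite -/(l i) /t mulrBr -addrA addrC.
have -> : - (M (l i) z * \sum_j M z (l j) * u j / a) + \sum_j M (l i) (l j) * u j = si i.
  rewrite addrC mulr_sumr -sumrB; apply: eq_bigr => j _; rewrite mxE mulrBl; congr (_ - _).
  by ring.
by have := dlS i; lra.
Qed.

Section CartanForm.
Variables (n : nat) (A : 'M[int]_n).
Hypothesis hA : finite_type_cartan A.

Let A2 i : A i i = 2. Proof. by case: hA. Qed.
Let Ale i j : i != j -> A i j <= 0. Proof. by case: hA => _ + _ _; apply. Qed.
Let A0 i j : (A i j == 0) = (A j i == 0). Proof. by case: hA. Qed.

Lemma cartan_minors k (f : 'I_k -> 'I_n) : injective f -> 0 < \det (mxsub f f A).
Proof. by case: hA => _ _ _ H; apply: (minors_of_set_minors H). Qed.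

Lemma cartan_det : 0 < \det A.
Proof.
have := @cartan_minors n id (fun x y e => e).
by have -> : mxsub id id A = A by apply/matrixP => i j; rewrite mxE.
Qed.

Lemma cartan_pos_vec : exists u : 'I_n -> rat, (forall i, 0 < u i) /\
  (forall i, 0 < \sum_j (A i j)%:~R * u j).
Proof.
have [||u [u0 Au]] := @mmatrix_pos_vec rat n (map_mx intr A).
- by move=> i j ij; rewrite mxE lerz0 Ale.
- move=> k f finj; have -> : mxsub f f (map_mx intr A) = map_mx intr (mxsub f f A) :> 'M[rat]_k.
    by apply/matrixP => i j; rewrite !mxE.
  by rewrite det_map_mx ltr0z cartan_minors.
exists u; split=> // i; have := Au i.
by congr (_ < _); apply: eq_bigr => j _; rewrite mxE.
Qed.

(* The Dynkin diagram is a forest: with b_ij = - u_i^-1 A_ij u_j, each row sum over S is less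
   than 2, whereas b_ij + b_ji >= 2 for adjacent i, j by AM-GM. *)
Lemma dynkin_leaf (S : {set 'I_n}) : S != set0 ->
  exists2 v, v \in S & (#|[set j in S | (j != v) && (A v j != 0)]| <= 1)%N.
Proof.
move=> S0; have [u [u0 Au]] := cartan_pos_vec.
apply/exists_inP; apply: contraT; rewrite negb_exists => /forallP H0.
have H i : i \in S -> ~~ (#|[set j in S | (j != i) && (A i j != 0)]| <= 1)%N by move=> iS; have := H0 i; rewrite iS.
pose b i j : rat := if i == j then 0 else - (A i j)%:~R * u j / u i.
have b0 i j : 0 <= b i j.
  rewrite /b; case: eqVneq => // ij; rewrite divr_ge0 ?(ltW (u0 _)) // mulr_ge0 ?(ltW (u0 _)) //.
  by rewrite oppr_ge0 lerz0 Ale.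
have row i : i \in S -> \sum_(j in S) b i j < 2.
  move=> iS; apply: (@le_lt_trans _ _ (\sum_j b i j)).
    by rewrite [leRHS](bigID [in S]) /= lerDl sumr_ge0.
  rewrite (bigD1 i) //= {1}/b eqxx add0r.
  have := Au i; rewrite (bigD1 i) //= A2 => lt.
  rewrite (eq_bigr (fun j => - ((A i j)%:~R * u j) / u i)); last first.
    by move=> j ji; rewrite /b eq_sym (negPf ji) !mulNr. 
  rewrite -mulr_suml ltr_pdivrMr // sumrN.
  by move: lt; move: (\sum_(j | j != i) _) => s lt; lra.
have bb i j : (i != j) && (A i j != 0) -> 2 <= b i j + b j i.
  move=> /andP[ij Aij]; rewrite /b (negPf ij) eq_sym (negPf ij).
  have ji : j != i by rewrite eq_sym.
  have Aji : A j i != 0 by rewrite -A0.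
  have h1 : 1 <= (- (A i j)%:~R : rat).
    by rewrite -mulrNz ler1z -gtz0_ge1 oppr_gt0 lt_neqAle Aij Ale.
  have h2 : 1 <= (- (A j i)%:~R : rat).
    by rewrite -mulrNz ler1z -gtz0_ge1 oppr_gt0 lt_neqAle Aji Ale.
  set x := u j / u i; have x0 : 0 < x by rewrite divr_gt0.
  rewrite -!mulrA -/x; have -> : u i / u j = x^-1 by rewrite invf_div.
  have xx : 2 <= x + x^-1.
    rewrite -subr_ge0; have -> : x + x^-1 - 2 = (x - 1) ^+ 2 / x by field; rewrite gt_eqF.
    by rewrite divr_ge0 ?sqr_ge0 ?ltW.
  apply: le_trans xx _; apply: lerD; first by rewrite -{1}[x]mul1r ler_pM2r.
  by rewrite -{1}[x^-1]mul1r ler_pM2r ?invr_gt0.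
pose T := \sum_(i in S) \sum_(j in S) b i j.
have T1 : T < 2 * #|S|%:R.
  rewrite -sum1_card natr_sum mulr_sumr; apply: ltr_sum.
    by have [v vS] := set0Pn _ S0; apply/hasP; exists v; rewrite ?mem_index_enum.
  by move=> i iS; rewrite mulr1; apply: row.
have T2 : T + T = \sum_(i in S) \sum_(j in S) (b i j + b j i).
  rewrite {2}/T exchange_big /= -big_split /=; apply: eq_bigr => i _.
  by rewrite -big_split.
have : 4 * #|S|%:R <= T + T.
  rewrite T2 -sum1_card natr_sum mulr_sumr; apply: ler_sum => i iS; rewrite mulr1.
  have := H i iS; rewrite -ltnNge => deg.
  apply: (@le_trans _ _ (\sum_(j in [set j in S | (j != i) && (A i j != 0)]) 2)).
    rewrite sumr_const -mulr_natr; have : (2 : rat) <= #|[set j in S | (j != i) && (A i j != 0)]|%:R.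
      by rewrite ler_nat.
    by lra.
  rewrite [leRHS](bigID (fun j => (j != i) && (A i j != 0))) /=.
  rewrite -[leLHS]addr0; apply: lerD; last by apply: sumr_ge0 => j _; rewrite addr_ge0.
  rewrite (eq_bigl (fun j => (j \in S) && ((j != i) && (A i j != 0)))); last by move=> j; rewrite inE.
  by apply: ler_sum => j /andP[_ ji]; apply: bb; rewrite eq_sym.
by lra.
Qed.

(** Induction by removing a leaf v: a symmetrizer of the rest extends, its value at v being forced
    by the only neighbour w, if there is one. *)
Lemma cartan_symmetrizer : exists d : 'I_n -> rat, (forall i, 0 < d i) /\
  forall i j, (A i j)%:~R * d j = (A j i)%:~R * d i.
Proof.
suff H k (S : {set 'I_n}) : (#|S| <= k)%N -> exists d : 'I_n -> rat, (forall i, 0 < d i) /\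
    forall i j, i \in S -> j \in S -> (A i j)%:~R * d j = (A j i)%:~R * d i.
  have [d [d0 dS]] := H _ setT (leqnn _); exists d; split=> // i j.
  by apply: dS; rewrite inE.
elim: k S => [|k IH] S.
  rewrite leqn0 cards_eq0 => /eqP ->; exists (fun=> 1); split=> // i j.
  by rewrite inE.
have [->|S0] := eqVneq S set0; first by exists (fun=> 1); split=> // i j; rewrite inE.
have [v vS leaf] := dynkin_leaf S0.
move=> cS; have [|d [d0 dS]] := IH (S :\ v).
  by rewrite -ltnS; move: cS; rewrite (cardsD1 v S) vS.
have [w0|[w wN]] := set_0Vmem [set j in S | (j != v) && (A v j != 0)].
  exists d; split=> // i j iS jS.
  have z k' : k' \in S -> k' != v -> A v k' = 0.
    move=> kS kv; have : k' \notin [set j in S | (j != v) && (A v j != 0)] by rewrite w0 inE.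
    by rewrite inE kS kv /= negbK => /eqP.
  have z' k' : k' \in S -> k' != v -> A k' v = 0.
    by move=> kS kv; apply/eqP; rewrite A0 z.
  have [->|iv] := eqVneq i v; have [->|jv] := eqVneq j v => //.
  - by rewrite z // z' // !mul0r.
  - by rewrite z // z' // !mul0r.
  by apply: dS; rewrite !inE ?iv ?jv.
have [wS [wv Avw]] : w \in S /\ (w != v) /\ (A v w != 0).
  by move: wN; rewrite inE => /and3P[-> -> ->].
have Awv : A w v != 0 by rewrite A0.
have vw : v != w by rewrite eq_sym.
have z k' : k' \in S -> k' != v -> k' != w -> A v k' = 0.
  move=> kS kv kw; apply/eqP/negPn/negP => Avk.
  have : [set w; k'] \subset [set j in S | (j != v) && (A v j != 0)].
    by apply/subsetP => x; rewrite !inE => /orP[] /eqP ->; rewrite ?wS ?wv ?kS ?kv.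
  move/subset_leq_card; rewrite cards2 eq_sym kw => /leq_trans/(_ leaf).
  by [].
have z' k' : k' \in S -> k' != v -> k' != w -> A k' v = 0.
  by move=> kS kv kw; apply/eqP; rewrite A0 z.
pose dv : rat := (A v w)%:~R * d w / (A w v)%:~R.
have dv0 : 0 < dv.
  rewrite /dv -mulrA [d w / _]mulrC mulrA mulr_gt0 // -mulrNN -invrN -!mulrNz divr_gt0 // ltr0z oppr_gt0 lt_neqAle ?Avw ?Awv Ale //.
exists (fun i => if i == v then dv else d i); split; first by move=> i; case: ifP.
have vvw k' : k' \in S -> k' != v -> (A v k')%:~R * d k' = (A k' v)%:~R * dv.
  move=> kS kv; have [->|kw] := eqVneq k' w; last by rewrite z ?z' // !mul0r.
  by rewrite /dv [RHS]mulrC divfK ?intr_eq0.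
move=> i j iS jS; case: eqVneq => [->|jv]; case: eqVneq => [->|iv] //.
- by rewrite vvw.
- by rewrite vvw.
by apply: dS; rewrite !inE ?iv ?jv.
Qed.

(** The matrix G_ij = A_ij d_j is symmetric with nonpositive off-diagonal entries, and e = u / d
    satisfies G e > 0. Since 2 c_i c_j <= (e_j / e_i) c_i^2 + (e_i / e_j) c_j^2, the off-diagonal
    part of the form is bounded below by a diagonal one, which leaves g_i = (G e)_i / e_i. The
    explicit lower bound also serves to bound the coordinates of roots. *)
Lemma cartan_posdef : exists d g : 'I_n -> rat, [/\ forall i, 0 < d i, forall i, 0 < g i,
  forall i j, (A i j)%:~R * d j = (A j i)%:~R * d i &
  forall c : 'I_n -> rat, \sum_i g i * c i ^+ 2 <= \sum_i \sum_j c i * ((A i j)%:~R * (d j * c j))].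
Proof.
have [u [u0 Au]] := cartan_pos_vec; have [d [d0 dsym]] := cartan_symmetrizer.
pose e i := u i / d i.
have e0 i : 0 < e i by rewrite divr_gt0.
pose G i j := (A i j)%:~R * d j.
have Ge i : \sum_j G i j * e j = \sum_j (A i j)%:~R * u j.
  by apply: eq_bigr => j _; rewrite /G /e -mulrA; congr (_ * _); rewrite mulrC divfK ?gt_eqF.
exists d, (fun i => (\sum_j G i j * e j) / e i); split=> //.
  by move=> i; rewrite divr_gt0 ?Ge.
move=> c.
pose F i j := G i j * e j / e i * c i ^+ 2.
have -> : \sum_i (\sum_j G i j * e j) / e i * c i ^+ 2 = \sum_i \sum_j F i j.
  by apply: eq_bigr => i _; rewrite !mulr_suml.
have FF : \sum_i \sum_j F i j = \sum_i \sum_j (F i j + F j i) / 2.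
  have -> : \sum_i \sum_j (F i j + F j i) / 2 = (\sum_i \sum_j F i j + \sum_i \sum_j F j i) / 2.
    by rewrite -big_split /= mulr_suml; apply: eq_bigr => i _; rewrite -mulr_suml -big_split.
  by rewrite [X in _ + X]exchange_big /=; field.
rewrite FF; apply: ler_sum => i _; apply: ler_sum => j _.
rewrite /F; have -> : G j i = G i j by rewrite /G dsym.
have -> : c i * ((A i j)%:~R * (d j * c j)) = G i j * (c i * c j) by rewrite /G; ring.
have [<-|ij] := eqVneq i j.
  by rewrite mulfK ?gt_eqF // le_eqVlt; apply/orP; left; apply/eqP; field.
have -> : (G i j * e j / e i * c i ^+ 2 + G i j * e i / e j * c j ^+ 2) / 2
   = G i j * ((e j / e i * c i ^+ 2 + e i / e j * c j ^+ 2) / 2) by ring.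
have Gle : G i j <= 0 by rewrite /G pmulr_lle0 // lerz0 Ale.
apply: ler_wnM2l => //; rewrite -subr_ge0.
have -> : (e j / e i * c i ^+ 2 + e i / e j * c j ^+ 2) / 2 - c i * c j =
    (e j * c i - e i * c j) ^+ 2 / (2 * (e i * e j)).
  by field; rewrite !gt_eqF.
apply: divr_ge0; first exact: sqr_ge0.
by apply: ltW; apply: mulr_gt0 => //; apply: mulr_gt0.
Qed.

End CartanForm.

(** * Roots and the Weyl group *)

Section Roots.
Variables (n : nat) (A : 'M[int]_n).
Hypothesis hA : finite_type_cartan A.
Implicit Types (i j k : 'I_n) (w : seq 'I_n).

Let A2 i : A i i = 2. Proof. by case: hA. Qed.
Let Ale i j : i != j -> A i j <= 0. Proof. by case: hA => _ + _ _; apply. Qed.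

(* The symmetry of the A_ij d_j pairs the off-diagonal terms; the diagonal ones are 2 c_i c'_i. *)
Lemma form_even (d : 'I_n -> rat) (di : rat) (c c' : 'I_n -> int) :
  0 < di -> (forall i j, (A i j)%:~R * d j = (A j i)%:~R * d i) ->
  (forall j, (c' j)%:~R * di = (c j)%:~R * d j) ->
  exists N : int, \sum_i \sum_j c i * A i j * c' j = 2 * N.
Proof.
move=> di0 dsym cc.
pose F i j := c i * A i j * c' j.
have Fsym i j : F i j = F j i.
  apply: (@intr_inj rat); apply: (mulIf (lt0r_neq0 di0)).
  rewrite /F !rmorphM /= -!(mulrA _ _ di) !cc.
  transitivity ((c i)%:~R * (c j)%:~R * ((A i j)%:~R * d j)); first by ring.
  by rewrite dsym; ring.
exists (\sum_(i < n) (c i * c' i + \sum_(j : 'I_n | (i < j)%N) F i j)).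
have -> : \sum_i \sum_j c i * A i j * c' j =
   \sum_(i < n) (F i i + \sum_(j : 'I_n | (i < j)%N) F i j) + \sum_(i < n) \sum_(j : 'I_n | (j < i)%N) F i j.
  rewrite -big_split /=; apply: eq_bigr => i _.
  rewrite (bigD1 i) //= -addrA; congr (_ + _).
  rewrite (bigID (fun j : 'I_n => (i < j)%N)) /=; congr (_ + _); apply: eq_bigl => j.
    by rewrite -val_eqE /=; lia.
  by rewrite -val_eqE /=; lia.
rewrite [X in _ + X](exchange_big_dep predT) //= mulr_sumr -big_split /=.
apply: eq_bigr => i _; rewrite {1}/F A2.
under [X in _ + X = _]eq_bigr => j _ do rewrite Fsym.
by move: (\sum_(j | _) _) => s; ring.
Qed.

Lemma form_pos (d g : 'I_n -> rat) (di : rat) (c c' : 'I_n -> int) :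
  0 < di -> (forall i, 0 < g i) ->
  (forall c : 'I_n -> rat, \sum_i g i * c i ^+ 2 <= \sum_i \sum_j c i * ((A i j)%:~R * (d j * c j))) ->
  (forall j, (c' j)%:~R * di = (c j)%:~R * d j) ->
  \sum_i g i * (c i)%:~R ^+ 2 <= (\sum_i \sum_j c i * A i j * c' j)%:~R * di.
Proof.
move=> di0 g0 pd cc; apply: le_trans (pd (fun i => (c i)%:~R)) _.
rewrite rmorph_sum mulr_suml; apply: ler_sum => i _.
rewrite rmorph_sum mulr_suml; apply: ler_sum => j _.
by rewrite !rmorphM /= -!mulrA cc [d j * _]mulrC.
Qed.

(** c stands for root coordinates and c' for coroot coordinates, so that the pairing is the
    normalized form but stays integral. As d > 0, c and c' agree in sign, so their positive parts
    are again proportional in the same way, and so are their negative parts. *)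
Lemma root_sign (d g : 'I_n -> rat) (di : rat) (c c' : 'I_n -> int) :
  0 < di -> (forall i, 0 < d i) -> (forall i, 0 < g i) ->
  (forall i j, (A i j)%:~R * d j = (A j i)%:~R * d i) ->
  (forall c : 'I_n -> rat, \sum_i g i * c i ^+ 2 <= \sum_i \sum_j c i * ((A i j)%:~R * (d j * c j))) ->
  (forall j, (c' j)%:~R * di = (c j)%:~R * d j) ->
  \sum_i \sum_j c i * A i j * c' j = 2 ->
  (forall j, 0 <= c j) \/ (forall j, c j <= 0).
Proof.
move=> di0 d0 g0 dsym pd cc q2.
have sgn j : (0 <= c' j) = (0 <= c j).
  by rewrite -(@ler0z rat) -(pmulr_lge0 _ di0) cc (pmulr_lge0 _ (d0 j)) ler0z.
have sgn' j : (c' j <= 0) = (c j <= 0).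
  by rewrite -(@lerz0 rat) -(pmulr_lle0 _ di0) cc (pmulr_lle0 _ (d0 j)) lerz0.
pose p (x : int) : int := if 0 <= x then x else 0.
pose m (x : int) : int := if 0 <= x then 0 else - x.
have pm x : x = p x - m x by rewrite /p /m; case: ifP => _; rewrite ?subr0 ?sub0r ?opprK.
have p0 x : 0 <= p x by rewrite /p; case: ifP.
have m0 x : 0 <= m x by rewrite /m; case: ifP => //; lia.
have ccp j : (p (c' j))%:~R * di = (p (c j))%:~R * d j.
  by rewrite /p sgn; case: ifP => _ //; rewrite !mul0r.
have ccm j : (m (c' j))%:~R * di = (m (c j))%:~R * d j.
  by rewrite /m sgn; case: ifP => _; rewrite ?mul0r // !rmorphN /= !mulNr cc.
pose q (x y : 'I_n -> int) := \sum_i \sum_j x i * A i j * y j.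
(* The cross terms vanish on the diagonal, where one of the two parts is zero, and contribute
   nonnegatively off it, since A_ij <= 0 there. *)
have qge : q (p \o c) (p \o c') + q (m \o c) (m \o c') <= 2.
  rewrite -q2 /q -big_split; apply: ler_sum => i _; rewrite -big_split; apply: ler_sum => j _ /=.
  rewrite [in leRHS](pm (c i)) [in leRHS](pm (c' j)).
  have [<-|ij] := eqVneq i j.
    have : p (c i) * m (c' i) = 0 by rewrite /p /m sgn; case: ifP => _; rewrite ?mulr0 ?mul0r.
    have : m (c i) * p (c' i) = 0 by rewrite /p /m sgn; case: ifP => _; rewrite ?mulr0 ?mul0r.
    by rewrite A2; move: (p _) (m _) (p (c' _)) (m (c' _)) => a b a' b'; nia.
  have := Ale ij; move: (p0 (c i)) (m0 (c i)) (p0 (c' j)) (m0 (c' j)).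
  move: (p (c i)) (m (c i)) (p (c' j)) (m (c' j)) (A i j) => a b a' b' e ha hb ha' hb' he.
  have := mulr_ge0 ha hb'; have := mulr_ge0 hb ha'; nia.
have big x y : (forall j, (y j)%:~R * di = (x j)%:~R * d j) -> (exists j, x j != 0) -> 2 <= q x y.
  move=> xy [j xj].
  have [N qN] := form_even di0 dsym xy.
  have := form_pos di0 g0 pd xy; rewrite -/(q x y) in qN *.
  have s0 : 0 < \sum_i g i * (x i)%:~R ^+ 2.
    rewrite (bigD1 j) //=; apply: ltr_pwDl.
      by rewrite mulr_gt0 // exprn_even_gt0 // intr_eq0.
    by apply: sumr_ge0 => k _; rewrite mulr_ge0 ?sqr_ge0 ?ltW.
  move/(lt_le_trans s0); rewrite pmulr_lgt0 // ltr0z qN; lia.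
have [/forallP h|] := boolP [forall j, 0 <= c j]; first by left.
rewrite negb_forall => /existsP[j cj].
right=> k; rewrite leNgt; apply/negP => ck.
have h1 : 2 <= q (p \o c) (p \o c').
  by apply: big => //; exists k; rewrite /= /p ltW // gt_eqF.
have h2 : 2 <= q (m \o c) (m \o c').
  apply: big => //; exists j; rewrite /= /m (negPf cj) oppr_eq0.
  by move: cj; rewrite -ltNge => /lt_eqF ->.
by move: h1 h2 qge; lia.
Qed.

Definition ec i : 'cV[int]_n := delta_mx i 0.
Definition er i : 'rV[int]_n := delta_mx 0 i.
Notation B := A^T.
Definition alpha i : 'cV[int]_n := B *m ec i.
(** The reflection in the basis of simple roots, where signs of roots can be read off; [B] passes
    from root to weight coordinates and intertwines it with [sref]. *)
Definition rref k : 'M[int]_n := 1%:M - ec k *m (er k *m B).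
Definition rprod w : 'M[int]_n := foldr (fun i M => rref i *m M) 1%:M w.

Lemma alphaE i k : alpha i k 0 = A i k.
Proof. by rewrite /alpha mxE (bigD1 i) //= big1 ?addr0 => [|j /negPf ji]; rewrite !mxE ?eqxx ?mulr1 ?ji ?mulr0. Qed.

Lemma srefE k : sref A k = 1%:M - alpha k *m er k.
Proof.
apply/matrixP => i j; rewrite !mxE big_ord1 alphaE !mxE eqxx /= mulrC.
by rewrite eq_sym [j == k]eq_sym; congr (_ - _); rewrite eq_sym.
Qed.

Lemma pair_alpha i : er i *m alpha i = 2%:M.
Proof.
by apply/matrixP => a b; rewrite !ord1 /er -rowE mxE alphaE A2 mxE eqxx.
Qed.

Lemma sref_rref k : sref A k *m B = B *m rref k.
Proof. by rewrite srefE /rref mulmxBl mulmxBr mul1mx mulmx1 /alpha !mulmxA. Qed.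

Lemma sref_mul k (v : 'cV[int]_n) : sref A k *m v = v - (v k 0) *: alpha k.
Proof.
rewrite srefE mulmxBl mul1mx -mulmxA; congr (_ - _).
rewrite [er k *m v]mx11_scalar /er -rowE mxE mul_mx_scalar //.
Qed.

Lemma sref_alpha k : sref A k *m alpha k = - alpha k.
Proof.
rewrite sref_mul alphaE A2 scaler_nat mulr2n opprD addrA subrr sub0r //.
Qed.

Lemma sref2 k : sref A k *m sref A k = 1%:M.
Proof.
rewrite {2}srefE mulmxBr mulmx1 mulmxA sref_alpha mulNmx opprK srefE subrK //.
Qed.

Lemma wprod_cat w r : wprod A (w ++ r) = wprod A w *m wprod A r.
Proof. by elim: w => [|i w IH] /=; rewrite ?mul1mx // IH mulmxA. Qed.

Lemma wprod_rev w : wprod A (rev w) *m wprod A w = 1%:M.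
Proof.
elim: w => [|i w IH]; first by rewrite mul1mx.
rewrite rev_cons -cats1 wprod_cat /= mulmx1 mulmxA -[_ *m sref A i *m sref A i]mulmxA sref2 mulmx1 IH //.
Qed.

Lemma wprod_rev' w : wprod A w *m wprod A (rev w) = 1%:M.
Proof. by rewrite -{1}(revK w) wprod_rev. Qed.

Lemma wprod_rprod w : wprod A w *m B = B *m rprod w.
Proof.
by elim: w => [|i w IH] /=; rewrite ?mul1mx ?mulmx1 // -mulmxA IH mulmxA sref_rref mulmxA.
Qed.

Lemma rprod_cat w r : rprod (w ++ r) = rprod w *m rprod r.
Proof. by elim: w => [|i w IH] /=; rewrite ?mul1mx // IH mulmxA. Qed.

Lemma detB_neq0 : \det B != 0.
Proof. by rewrite det_tr gt_eqF // cartan_det. Qed.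

(** Over the integers [B] need not be invertible; the adjugate and the nonzero determinant take the
    place of an inverse. *)
Lemma BI p (M N : 'M[int]_(n, p)) : B *m M = B *m N -> M = N.
Proof.
move=> /(congr1 (mulmx (\adj B))); rewrite !mulmxA mul_adj_mx !mul_scalar_mx => E.
by apply/matrixP => i j; move/matrixP/(_ i j): E; rewrite !mxE => /(mulfI detB_neq0).
Qed.

Lemma BIr p (M N : 'M[int]_(p, n)) : M *m B = N *m B -> M = N.
Proof.
move=> /(congr1 (mulmx^~ (\adj B))); rewrite -!mulmxA mul_mx_adj !mul_mx_scalar => E.
by apply/matrixP => i j; move/matrixP/(_ i j): E; rewrite !mxE => /(mulfI detB_neq0).
Qed.

(* Root coordinates of w alpha_i, and coroot coordinates of w alpha_i^vee. *)
Definition rc w i : 'cV[int]_n := rprod w *m ec i.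
Definition crc w i : 'rV[int]_n := er i *m wprod A (rev w).

Lemma wprod_alpha w i : wprod A w *m alpha i = B *m rc w i.
Proof. by rewrite /alpha /rc !mulmxA wprod_rprod. Qed.

Lemma rc_pairing w i : \sum_a \sum_b rc w i a 0 * A a b * crc w i 0 b = 2.
Proof.
have : crc w i *m (B *m rc w i) = 2%:M.
  rewrite -wprod_alpha /crc mulmxA -(mulmxA _ (wprod A (rev w))) wprod_rev mulmx1.
  exact: pair_alpha.
move/matrixP/(_ 0 0); rewrite !mxE eqxx mulr1n => <-.
rewrite exchange_big /=; apply: eq_bigr => b _; rewrite !mxE mulr_sumr.
by apply: eq_bigr => a _; rewrite !mxE; ring.
Qed.

Lemma crc_cons w i k j : crc (k :: w) i 0 j = crc w i 0 j - (j == k)%:R * \sum_l A k l * crc w i 0 l.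
Proof.
rewrite /crc rev_cons -cats1 wprod_cat /= mulmx1 mulmxA -/(crc w i) srefE mulmxBr mulmx1 mxE.
congr (_ + _); rewrite mxE; congr (- _); rewrite mulmxA mxE big_ord1 mulrC; congr (_ * _).
  by rewrite mxE eqxx.
by rewrite mxE; apply: eq_bigr => l _; rewrite alphaE mulrC.
Qed.

Lemma rc_cons w i k j : rc (k :: w) i j 0 = rc w i j 0 - (j == k)%:R * \sum_l A l k * rc w i l 0.
Proof.
rewrite /rc /= -mulmxA -/(rc w i) /rref mulmxBl mul1mx mxE; congr (_ + _); rewrite mxE.
congr (- _); rewrite -mulmxA mxE big_ord1; congr (_ * _); first by rewrite mxE eqxx andbT.
rewrite -mulmxA /er -rowE mxE mxE; apply: eq_bigr => l _; by rewrite mxE.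
Qed.

(** The coroot is the root rescaled by d: this is clear for the empty word, and the symmetry of A_ij
    d_j carries it through the recursions [crc_cons] and [rc_cons]. *)
Lemma rc_crc (d : 'I_n -> rat) w i j : (forall i j, (A i j)%:~R * d j = (A j i)%:~R * d i) ->
  (crc w i 0 j)%:~R * d i = (rc w i j 0)%:~R * d j.
Proof.
move=> dsym; elim: w j => [|k w IH] j.
  rewrite /crc /rc /= mulmx1 mul1mx !mxE !eqxx andbT /=.
  by case: eqVneq => [->|]; rewrite ?mul0r.
rewrite crc_cons rc_cons !rmorphB /= !rmorphM /= !mulrBl IH; congr (_ - _).
case: eqVneq => [->|]; last by rewrite !mul0r.
rewrite !mul1r !rmorph_sum !mulr_suml; apply: eq_bigr => l _.
rewrite !rmorphM /= -mulrA IH.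
transitivity ((rc w i l 0)%:~R * ((A k l)%:~R * d l)); first by ring.
by rewrite dsym; ring.
Qed.

Lemma rc_sign w i : (forall j, 0 <= rc w i j 0) \/ (forall j, rc w i j 0 <= 0).
Proof.
have [d [g [d0 g0 dsym pd]]] := cartan_posdef hA.
apply: (@root_sign d g (d i) _ (crc w i 0)) => //; last exact: rc_pairing.
by move=> j; apply: rc_crc.
Qed.

(** A root pairs to 2 with its own coroot, so the definite form gives g_j c_j^2 <= 2 d_i for each
    coordinate c_j. This bound is what makes W finite. *)
Lemma rc_bound : exists K : nat, forall w i j, (`|rc w i j 0%R| <= K)%N.
Proof.
have [d [g [d0 g0 dsym pd]]] := cartan_posdef hA.
pose b i j : rat := 2 * d i / g j.
exists (\max_(x : 'I_n * 'I_n) `|Num.ceil (b x.1 x.2)|)%N => w i j.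
apply: leq_trans (leq_bigmax (i, j)) => /=.
have := @form_pos d g (d i) (fun a => rc w i a 0) (fun a => crc w i 0 a) (d0 i) g0 pd.
rewrite rc_pairing => /(_ (fun j => rc_crc w i j dsym)) le.
have {}le : g j * (rc w i j 0)%:~R ^+ 2 <= 2 * d i.
  apply: le_trans le; rewrite (bigD1 j) //= lerDl.
  by apply: sumr_ge0 => k _; rewrite mulr_ge0 ?sqr_ge0 ?ltW.
have {}le : (rc w i j 0 ^+ 2)%:~R <= b i j.
  by rewrite /b ler_pdivlMr // mulrC rmorphXn.
have {le} : rc w i j 0 ^+ 2 <= Num.ceil (b i j).
  by rewrite -(@ler_int rat); apply: le_trans le (ceil_ge _).
nia.
Qed.

End Roots.

(** * Signs of roots and finiteness of the Weyl group *)

Section RootSigns.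
Variables (n : nat) (A : 'M[int]_n).
Hypothesis hA : finite_type_cartan A.
Implicit Types (i j k : 'I_n) (w r : seq 'I_n).
Notation B := A^T.

Let A2 i : A i i = 2. Proof. by case: hA. Qed.

Lemma er_ec i j : er i *m ec j = (i == j)%:R%:M.
Proof. by apply/matrixP => a b; rewrite !ord1 /er -rowE !mxE eqxx andbT mulr1n. Qed.

Lemma rprod_coord w k : k \notin w -> er k *m rprod A w = er k.
Proof.
elim: w => [|i w IH]; first by rewrite mulmx1.
rewrite inE negb_or => /andP[ki kw] /=.
rewrite mulmxA /rref mulmxBr mulmx1 [er k *m (ec i *m _)]mulmxA er_ec (negPf ki).
by rewrite mul_scalar_mx scale0r subr0 IH.
Qed.

(** Entries of [rprod] are root coordinates, hence bounded by K, so only finitely many matrices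
    occur. They are coded with entries shifted by K and one word is chosen for each code, the empty
    word being the default for codes that do not occur. *)
Lemma wprod_word_bound : exists N, forall w, exists2 r, (size r <= N)%N & wprod A r = wprod A w.
Proof.
have [K hK] := rc_bound hA.
pose dec (M : 'M['I_(K + K).+1]_n) : 'M[int]_n := map_mx (fun x : 'I_(K + K).+1 => (x : nat)%:Z - K%:Z) M.
have decS w : exists M, dec M = rprod A w.
  exists (\matrix_(a, b) inord (absz (rprod A w a b + K%:Z)%R)).
  apply/matrixP => a b; rewrite !mxE.
  have : (`|rprod A w a b| <= K)%N.
    suff -> : rprod A w a b = rc A w b a 0 by [].
    by rewrite /rc /ec -colE mxE.
  by move=> le; rewrite inordK; lia.
have ch M : exists r, forall w, rprod A w = dec M -> rprod A r = dec M.
  have [[r rM]|no] := pselect (exists r, rprod A r = dec M); first by exists r.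
  by exists [::] => w wM; case: no; exists w.
have [f hf] := boolp.choice ch.
exists (\max_M size (f M))%N => w; have [M MD] := decS w.
exists (f M); first exact: (leq_bigmax M).
by apply: (BIr hA); rewrite !wprod_rprod (hf M w (esym MD)) MD.
Qed.

(** Stated for a matrix and not for a word, so that it depends on the group element only. *)
Definition posm (g : 'M[int]_n) i : bool :=
  `[< exists2 c : 'cV[int]_n, (forall j, 0 <= c j 0) & g *m alpha A i = B *m c >].

Lemma posm_word w i : posm (wprod A w) i <-> forall j, 0 <= rc A w i j 0.
Proof.
split; last by move=> H; apply/asboolP; exists (rc A w i); rewrite ?wprod_alpha.
by move=> /asboolP[c c0]; rewrite wprod_alpha => /(BI hA) ->.
Qed.

Lemma posm_wordN w i : ~~ posm (wprod A w) i -> forall j, rc A w i j 0 <= 0.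
Proof. by move=> /negP; rewrite posm_word; case: (rc_sign hA w i). Qed.

Lemma rc_rcons w i : rc A (rcons w i) i = - rc A w i.
Proof.
apply: (BI hA); rewrite mulmxN -!wprod_alpha -cats1 wprod_cat /= mulmx1.
by rewrite -mulmxA (sref_alpha hA) mulmxN.
Qed.

Lemma rc_neq0 w i : rc A w i != 0.
Proof.
apply/eqP => E; have := rc_pairing hA w i; rewrite E.
by rewrite big1 // => a _; rewrite big1 // => b _; rewrite mxE !mul0r.
Qed.

Lemma posm1 i : posm 1%:M i.
Proof. by apply/asboolP; exists (ec i) => [j|]; rewrite ?mxE ?mul1mx //; case: (_ && _). Qed.

Lemma posm_sref w i : posm (wprod A w *m sref A i) i = ~~ posm (wprod A w) i.
Proof.
have E : wprod A w *m sref A i = wprod A (rcons w i) by rewrite -cats1 wprod_cat /= mulmx1.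
rewrite E; case: (boolP (posm (wprod A w) i)) => [/posm_word ge|/posm_wordN le] /=.
  apply/negP => /posm_word; rewrite rc_rcons => ge'.
  case/eqP: (rc_neq0 w i); apply/matrixP => j b; rewrite ord1 [RHS]mxE.
  by apply/eqP; rewrite eq_le ge andbT; have := ge' j; rewrite mxE oppr_ge0.
by apply/posm_word => j; rewrite rc_rcons mxE oppr_ge0.
Qed.

(** s_j changes only the coordinate at j, so a positive root that it makes negative is a multiple of
    alpha_j. The same holds for the coroot, and the pairing 2 x y = 2 forces both multiples to be 1;
    the rank one formula for reflections then gives the equality. *)
Lemma posm_left w i j : posm (wprod A w) i -> ~~ posm (sref A j *m wprod A w) i ->
  sref A j *m wprod A w = wprod A w *m sref A i.
Proof.
move=> /posm_word ge /(@posm_wordN (j :: w)) le.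
have z k : k != j -> rc A w i k 0 = 0.
  move=> kj; apply/eqP; rewrite eq_le ge andbT.
  by have := le k; rewrite rc_cons (negPf kj) mul0r subr0.
have [d [g [d0 g0 dsym _]]] := cartan_posdef hA.
have zc k : k != j -> crc A w i 0 k = 0.
  move=> kj; have := rc_crc w i k dsym; rewrite (z k kj) mul0r => /eqP.
  by rewrite mulf_eq0 intr_eq0 (gt_eqF (d0 i)) orbF => /eqP.
have := rc_pairing hA w i; rewrite (bigD1 j) //= [X in _ + X]big1 => [|k kj]; last first.
  by rewrite big1 // => b _; rewrite z // !mul0r.
rewrite addr0 (bigD1 j) //= [X in _ + X]big1 => [|k kj]; last by rewrite zc // mulr0.
rewrite addr0 A2 => E.
have [r1 c1] : rc A w i j 0 = 1 /\ crc A w i 0 j = 1.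
  move: (ge j) E; move: (rc A w i j 0) (crc A w i 0 j) => x y x0 E.
  have {E} xy : x * y = 1 by lia.
  have y0 : 0 < y by nia.
  have x1 : 0 < x by nia.
  by split; nia.
have rE : rc A w i = ec j.
  apply/matrixP => k b; rewrite ord1 [RHS]mxE eqxx andbT.
  by case: eqVneq => [->|/z].
have cE : crc A w i = er j.
  apply/matrixP => b k; rewrite ord1 [RHS]mxE eqxx /=.
  by case: eqVneq => [->|/zc].
have gi : wprod A w *m alpha A i = alpha A j by rewrite wprod_alpha rE.
have ci : er i = er j *m wprod A w.
  by rewrite -cE /crc -mulmxA wprod_rev // mulmx1.
by rewrite !srefE mulmxBl mulmxBr mul1mx mulmx1 -mulmxA -ci mulmxA gi.
Qed.

Lemma sref_inj : injective (sref A).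
Proof.
move=> i j E; apply/eqP/negPn/negP => ij.
have := sref_alpha hA i; rewrite E sref_mul alphaE.
have -> : - alpha A i = B *m (- ec i) by rewrite mulmxN.
have -> : alpha A i - A i j *: alpha A j = B *m (ec i - A i j *: ec j).
  by rewrite mulmxBr -scalemxAr.
move/(BI hA)/matrixP/(_ i 0); rewrite !mxE !eqxx (negPf ij) /= mulr0 subr0.
by [].
Qed.

Lemma inW_inv (g : 'M[int]_n) : inW A g -> exists h, [/\ inW A h, h *m g = 1%:M & g *m h = 1%:M].
Proof.
move=> [w <-]; exists (wprod A (rev w)).
by rewrite wprod_rev // wprod_rev' //; split=> //; exists (rev w).
Qed.

Lemma inW_mul (g h : 'M[int]_n) : inW A g -> inW A h -> inW A (g *m h).
Proof. by move=> [w <-] [r <-]; exists (w ++ r); rewrite wprod_cat. Qed.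

Lemma inW1 : inW A 1%:M. Proof. by exists [::]. Qed.

Lemma inW_sref i : inW A (sref A i). Proof. by exists [:: i]; rewrite /= mulmx1. Qed.

End RootSigns.

(** * The Weyl group as a Coxeter system *)

Definition weyl n (A : 'M[int]_n) (hA : finite_type_cartan A) := {g : 'M[int]_n | `[< inW A g >]}.

Section WeylGroup.
Variables (n : nat) (A : 'M[int]_n) (hA : finite_type_cartan A).

HB.instance Definition _ := Choice.copy (weyl hA) {g : 'M[int]_n | `[< inW A g >]}.

Let wval (g : weyl hA) : 'M[int]_n := sval g.
Let wsub (g : 'M[int]_n) (Wg : inW A g) : weyl hA := exist _ g (introT (asboolP _) Wg).
Let wvalP (g : weyl hA) : inW A (wval g). Proof. exact: (elimT (asboolP _) (svalP g)). Qed.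
Let wval_inj : injective wval. Proof. exact: val_inj. Qed.

Definition weyl_one : weyl hA := wsub (inW1 A).
Definition weyl_mul (g h : weyl hA) : weyl hA := wsub (inW_mul (wvalP g) (wvalP h)).
Lemma weyl_inv_ex (g : weyl hA) : exists h : weyl hA, weyl_mul h g = weyl_one /\ weyl_mul g h = weyl_one.
Proof.
by have [h [Wh hg gh]] := inW_inv hA (wvalP g); exists (wsub Wh); split; apply: wval_inj.
Qed.
Definition weyl_inv g : weyl hA := projT1 (cid (weyl_inv_ex g)).

Fact weyl_mulA : associative weyl_mul.
Proof. by move=> g h k; apply: wval_inj; exact: mulmxA. Qed.
Fact weyl_mul1 : left_id weyl_one weyl_mul.
Proof. by move=> g; apply: wval_inj; exact: mul1mx. Qed.
Fact weyl_1mul : right_id weyl_one weyl_mul.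
Proof. by move=> g; apply: wval_inj; exact: mulmx1. Qed.
Fact weyl_mulV : left_inverse weyl_one weyl_inv weyl_mul.
Proof. by move=> g; rewrite /weyl_inv; case: cid => h []. Qed.
Fact weyl_Vmul : right_inverse weyl_one weyl_inv weyl_mul.
Proof. by move=> g; rewrite /weyl_inv; case: cid => h []. Qed.

HB.instance Definition _ := isGroup.Build (weyl hA)
  weyl_mulA weyl_mul1 weyl_1mul weyl_mulV weyl_Vmul.

Definition wv (g : weyl hA) : 'M[int]_n := wval g.
Definition weyl_sg i : weyl hA := wsub (inW_sref A i).

Lemma wv_inj : injective wv. Proof. exact: wval_inj. Qed.
Lemma wvP g : inW A (wv g). Proof. exact: wvalP. Qed.
Lemma wvM g h : wv (g * h)%g = wv g *m wv h. Proof. by []. Qed.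
Lemma wv_sg i : wv (weyl_sg i) = sref A i. Proof. by []. Qed.
Lemma wv_wordprod w : wv (wordprod weyl_sg w) = wprod A w.
Proof. by elim: w => [//|i w IH]; rewrite [LHS](wvM _ (wordprod weyl_sg w)) IH. Qed.
Lemma wv_ex (g : 'M[int]_n) : inW A g -> exists h, wv h = g.
Proof. by move=> Wg; exists (wsub Wg). Qed.
Lemma wv_word g : exists w, wprod A w = wv g.
Proof. exact: wvP. Qed.

Fact weyl_sg2 i : (weyl_sg i * weyl_sg i)%g = 1%g.
Proof. by apply: wv_inj; rewrite wvM wv_sg sref2. Qed.
Fact weyl_sg_inj : injective weyl_sg.
Proof. by move=> i j /(congr1 wv); rewrite !wv_sg => /(sref_inj hA). Qed.
Definition weyl_pos g i := posm A (wv g) i.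
Fact weyl_pos1 i : weyl_pos 1%g i.
Proof. exact: posm1. Qed.
Fact weyl_posS g i : weyl_pos (g * weyl_sg i)%g i = ~~ weyl_pos g i.
Proof. by rewrite /weyl_pos wvM wv_sg; have [w <-] := wv_word g; rewrite posm_sref. Qed.
Fact weyl_posL g i j : weyl_pos g i -> ~~ weyl_pos (weyl_sg j * g)%g i ->
  (weyl_sg j * g = g * weyl_sg i)%g.
Proof.
rewrite /weyl_pos wvM wv_sg => pg npg; apply: wv_inj; rewrite !wvM !wv_sg.
by have [w wE] := wv_word g; move: pg npg; rewrite -wE; apply: posm_left.
Qed.
Fact weyl_word_bound : exists N, forall g, exists2 w, (size w <= N)%N & wordprod weyl_sg w = g.
Proof.
have [N hN] := wprod_word_bound hA; exists N => g.
have [w wE] := wv_word g; have [r rN rE] := hN w; exists r => //.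
by apply: wv_inj; rewrite wv_wordprod rE.
Qed.

Definition coxW : coxSys n := CoxSys weyl_sg2 weyl_sg_inj weyl_pos1 weyl_posS weyl_posL weyl_word_bound.

End WeylGroup.

(** * Translation of the matrix definitions into the Coxeter system *)

Section Transfer.
Variables (n : nat) (A : 'M[int]_n) (hA : finite_type_cartan A).
Notation W := (coxW hA).
Implicit Types (g h u v : W) (J K : {set 'I_n}) (x y : 'M[int]_n) (w r : seq 'I_n).

Definition wmx (g : W) : 'M[int]_n := wv g.

Lemma wmx_inj : injective wmx. Proof. exact: wv_inj. Qed.
Lemma wmx1 : wmx 1%g = 1%:M. Proof. by []. Qed.
Lemma wmxM g h : wmx (g * h)%g = wmx g *m wmx h. Proof. by []. Qed.
Lemma wmx_sg i : wmx (sg i) = sref A i. Proof. by []. Qed.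
Lemma wmx_wp w : wmx (wp W w) = wprod A w.
Proof. by rewrite wpE; exact: (wv_wordprod hA). Qed.
Lemma inW_wmx g : inW A (wmx g). Proof. exact: wvP. Qed.
Lemma wmx_ex x : inW A x -> exists g, x = wmx g.
Proof. by move=> /(wv_ex hA)[g gE]; exists g. Qed.
Lemma wp_wmx w g : wprod A w = wmx g -> wp W w = g.
Proof. by rewrite -wmx_wp => /wmx_inj. Qed.

Lemma len_wmx g k : (forall w, wprod A w = wmx g -> (k <= size w)%N) <-> (k <= len g)%N.
Proof.
split=> [H|le w wE].
  by have [w <- wE] := lenP g; apply: H; rewrite -wE wmx_wp.
by apply: leq_trans le _; rewrite -(wp_wmx wE); exact: len_le.
Qed.

Lemma reduced_wmx w g : reduced A w (wmx g) <-> reducedw W w /\ wp W w = g.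
Proof.
rewrite /reduced /reducedw; split=> [[/wp_wmx wE min]|[/eqP rw wE]].
  split=> //; rewrite eqn_leq len_le andbT wE.
  by have [r <- rE] := lenP g; apply: min; rewrite -rE wmx_wp.
by split; [rewrite -wE wmx_wp|apply/len_wmx; rewrite rw wE].
Qed.

Lemma bruhat_wmx u v : bruhat A (wmx u) (wmx v) <-> ble u v.
Proof.
rewrite bleP; split=> [[w [t [/reduced_wmx[rw wE] [st /wp_wmx tE]]]]|[w [t [rw wE st tE]]]].
  by exists w, t.
by exists w, t; split; [apply/reduced_wmx|split=> //; rewrite -tE wmx_wp].
Qed.

Lemma inWJ_wmx J g : inWJ A J (wmx g) <-> inP J g.
Proof.
split=> [[w [aw /wp_wmx wE]]|[w aw wE]]; first by exists w.
by exists w; split=> //; rewrite -wE wmx_wp.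
Qed.

Lemma inWJ_ex J x : inWJ A J x -> exists2 g, x = wmx g & inP J g.
Proof. by move=> [w [aw <-]]; exists (wp W w); rewrite ?wmx_wp //; exists w. Qed.

Lemma in_coset_wmx J g x : in_coset A J (wmx g) x <-> exists2 h, x = wmx h & inP J (g^-1 * h)%g.
Proof.
split=> [[y [/inWJ_ex[h -> Jh] ->]]|[h -> Jh]].
  by exists (g * h)%g; rewrite ?wmxM // mulKg.
exists (wmx (g^-1 * h)%g); split; first exact/inWJ_wmx.
by rewrite -wmxM mulVKg.
Qed.

Lemma lenle_wmx u v : lenle A (wmx u) (wmx v) <-> (len u <= len v)%N.
Proof.
split=> [H|le w /wp_wmx wE].
  have [w wl wE] := lenP v; have [|t [/wp_wmx tE]] := H w; first by rewrite -wE wmx_wp.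
  by rewrite wl; apply: leq_trans; rewrite -tE; exact: len_le.
have [t tl tE] := lenP u; exists t; rewrite -wmx_wp tE tl; split=> //.
by apply: leq_trans le _; rewrite -wE; exact: len_le.
Qed.

Lemma is_minrep_wmx J g x : is_minrep A J (wmx g) x <-> x = wmx (mr J g).
Proof.
split=> [[/in_coset_wmx[h -> Jh] hmin]|->].
  congr wmx; rewrite -[h](@mr_id _ _ J); first by apply/esym/mrP.
  apply/isup_min => y Jy; apply/lenle_wmx; apply: hmin; apply/in_coset_wmx.
  by exists (h * y)%g => //; rewrite mulgA; apply: inPM.
split; first by apply/in_coset_wmx; exists (mr J g) => //; exact: mr_in.
move=> x' /in_coset_wmx[h -> /mrP ->]; apply/lenle_wmx/ble_len; exact: mr_ble.
Qed.

Lemma is_maxrep_wmx J g x : is_maxrep A J (wmx g) x <-> x = wmx (mx J g).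
Proof.
split=> [[/in_coset_wmx[h -> Jh] hmax]|->].
  congr wmx; apply: ble_eq; first exact: ble_mx.
  apply/lenle_wmx; apply: hmax; apply/in_coset_wmx; exists (mx J g) => //; exact: mx_in.
split; first by apply/in_coset_wmx; exists (mx J g) => //; exact: mx_in.
by move=> x' /in_coset_wmx[h -> Jh]; apply/lenle_wmx/ble_len; exact: ble_mx.
Qed.

Lemma epsilon_unique (T : Type) (t0 : inhabited T) (P : T -> Prop) a :
  P a -> (forall b, P b -> b = a) -> epsilon t0 P = a.
Proof. by move=> Pa H; apply: H; apply: epsilon_spec; exists a. Qed.

Lemma minrep_wmx J g : minrep A J (wmx g) = wmx (mr J g).
Proof. by apply: epsilon_unique; [apply/is_minrep_wmx|move=> b /is_minrep_wmx]. Qed.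

Lemma maxrep_wmx J g : maxrep A J (wmx g) = wmx (mx J g).
Proof. by apply: epsilon_unique; [apply/is_maxrep_wmx|move=> b /is_maxrep_wmx]. Qed.

Lemma inWup_wmx J g : inWup A J (wmx g) <-> isup J g.
Proof.
rewrite /inWup is_minrep_wmx; split=> [[_ /wmx_inj ->]|up]; first exact: isup_mr.
by rewrite mr_id //; split=> //; exact: inW_wmx.
Qed.

Lemma inWup_ex J x : inWup A J x -> exists2 g, x = wmx g & isup J g.
Proof. by move=> H; have [g E] := wmx_ex H.1; exists g => //; apply/inWup_wmx; rewrite -E. Qed.

Lemma w0_wmx : w0 A = wmx (wl W setT).
Proof.
rewrite /w0 -wmx1 maxrep_wmx /mx mr_id ?mul1g //; exact: isup1.
Qed.

Lemma minpre_wmx J K g : J \subset K -> minpre A J K (wmx g) = wmx (mr K g).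
Proof.
move=> JK; have P : [/\ inWup A J (wmx (mr K g)), minrep A K (wmx (mr K g)) = minrep A K (wmx g) &
     forall ps, inWup A J ps -> minrep A K ps = minrep A K (wmx g) -> bruhat A (wmx (mr K g)) ps].
  split; first by apply/inWup_wmx; apply: isup_mono JK (isup_mr K g).
    by rewrite !minrep_wmx mr_id //; exact: isup_mr.
  move=> ps /inWup_ex[p -> _]; rewrite !minrep_wmx => /wmx_inj <-.
  by apply/bruhat_wmx; exact: mr_ble.
apply: (epsilon_unique _ P) => b [Jb bE bmin]; case: P => Jm mE mmin.
have [h hE _] := inWup_ex Jb; subst b; congr wmx; apply: ble_anti.
  by apply/bruhat_wmx; apply: bmin.
by apply/bruhat_wmx; apply: mmin.
Qed.

(** Every element of the fibre lies below the longest element of g W_K, and is still below it after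
    projection to W^J. *)
Lemma maxpre_wmx J K g : J \subset K -> maxpre A J K (wmx g) = wmx (mr J (mx K g)).
Proof.
move=> JK; have P : [/\ inWup A J (wmx (mr J (mx K g))),
     minrep A K (wmx (mr J (mx K g))) = minrep A K (wmx g) &
     forall ps, inWup A J ps -> minrep A K ps = minrep A K (wmx g) -> bruhat A ps (wmx (mr J (mx K g)))].
  split; first by apply/inWup_wmx; exact: isup_mr.
    by rewrite !minrep_wmx mr_mr // mr_mx.
  move=> ps /inWup_ex[p -> up]; rewrite !minrep_wmx => /wmx_inj/mrP/inP_cosetC Kp.
  by apply/bruhat_wmx; apply: isup_ble_mr => //; exact: ble_mx.
apply: (epsilon_unique _ P) => b [Jb bE bmax]; case: P => Jm mE mmax.
have [h hE _] := inWup_ex Jb; subst b; congr wmx; apply: ble_anti.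
  by apply/bruhat_wmx; apply: mmax.
by apply/bruhat_wmx; apply: bmax.
Qed.

Lemma sg_comm (i j : 'I_n) : i != j -> A i j = 0 -> (sg i * sg j = sg j * sg i :> W)%g.
Proof.
move=> ij Aij; have Aji : A j i = 0.
  by apply/eqP; case: (hA) => _ _ <- _; rewrite Aij.
have z a b : A a b = 0 -> er b *m alpha A a = 0.
  by move=> Aab; apply/matrixP => c d; rewrite !ord1 /er -rowE mxE alphaE Aab mxE.
have zz a b : A a b = 0 -> alpha A b *m er b *m (alpha A a *m er a) = 0.
  by move=> Aab; rewrite -mulmxA [er b *m _]mulmxA z // mul0mx mulmx0.
apply: wmx_inj; rewrite !wmxM !wmx_sg !srefE !mulmxBl !mulmxBr !mul1mx !mulmx1.
by rewrite !zz // !subr0 addrAC.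
Qed.

(** Let u be the element of j :: w. If s_i commuted with u, the root r = u^-1 alpha_i would satisfy
    s_i r = - r and be proportional to alpha_i. But its coordinate at j is - A_ij: it is created by
    s_j and kept by the letters of w, which differ from j. *)
Lemma sg_noncomm (i j : 'I_n) w : uniq [:: i, j & w] -> A i j != 0 ->
  (sg i * wp W (j :: w) <> wp W (j :: w) * sg i)%g.
Proof.
rewrite /= inE negb_or => /and3P[/andP[ij iw] jw _] Aij E.
have E' : (sg i * wp W (rev (j :: w)) = wp W (rev (j :: w)) * sg i)%g.
  rewrite wp_rev; apply: (mulIg (wp W (j :: w))); apply: (mulgI (wp W (j :: w))).
  by rewrite mulgVK -!mulgA -E !mulVKg.
move/(congr1 wmx): E'; rewrite !wmxM wmx_sg wmx_wp => E'.
set r := rev _ in E'.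
have := congr1 (mulmx^~ (alpha A i)) E'; rewrite -!mulmxA (sref_alpha hA) mulmxN.
rewrite wprod_alpha sref_mul.
set c := (B in B *: _) => E2.
have : A^T *m (2 *: rc A r i) = A^T *m (c *: ec i).
  rewrite -!scalemxAr scaler_nat mulr2n.
  by apply/eqP; rewrite -subr_eq0 -addrA E2 subrr.
move/(BI hA)/matrixP/(_ j 0); rewrite [LHS]mxE [RHS]mxE [ec i j 0]mxE eq_sym (negPf ij) mulr0.
move/eqP; rewrite mulf_eq0 /= => /eqP.
have -> : rc A r i j 0 = (er j *m rc A r i) 0 0 by rewrite /er -rowE [RHS]mxE.
have ra : er j *m alpha A i = (A i j)%:M.
  by apply/matrixP => a b; rewrite !ord1 /er -rowE [LHS]mxE alphaE mxE.
rewrite /rc /r rev_cons -cats1 rprod_cat /= mulmx1 !mulmxA rprod_coord ?mem_rev //.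
rewrite /rref mulmxBr mulmx1 mulmxBl -!mulmxA -/(alpha A i) [er j *m (ec j *m _)]mulmxA.
rewrite !er_ec eqxx mul1mx eq_sym (negPf ij) ra.
by rewrite !mxE mul0rn sub0r mulr1n => /eqP; rewrite oppr_eq0 (negPf Aij).
Qed.

(** If s_{x0} created a descent s_j, [posL] would give s_{x0} u = u s_j for the product u over the
    rest of the path. Supports exclude every j other than x0, and j = x0 contradicts
    [sg_noncomm]. *)
Lemma path_desc (x0 : 'I_n) p j : path (dynkin_adj A) x0 p -> uniq (x0 :: p) -> j != last x0 p ->
  pos (wp W (x0 :: p)) j.
Proof.
have supp (K : {set 'I_n}) w : {subset w <= K} -> inP K (wp W w).
  by move=> wK; exists w => //; apply/allP.
elim: p x0 j => [|y p IH] x0 j /=.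
  move=> _ _ jx; apply/negPn/negP; rewrite wp1 -[sg x0]mulg1 => npj.
  have := posL (pos1 W j) npj; rewrite mulg1 mul1g => /sg_inj xj.
  by rewrite xj eqxx in jx.
move=> /andP[xy yp] /andP[xN uyp] jl; apply/negPn/negP; rewrite wp_cons => npj.
have E := posL (IH y j yp uyp jl) npj.
set u := wp W (y :: p) in E.
have uK : inP [set z in y :: p] u by apply: supp => z zp; rewrite inE.
have [jx|jx] := eqVneq j x0.
  move: E; rewrite jx; apply: sg_noncomm; first by rewrite /= xN.
  by case/andP: xy.
have [jp|jp] := boolP (j \in y :: p).
  have : inP [set z in y :: p] (sg x0 : W).
    have -> : sg x0 = (u * sg j * u^-1)%g by rewrite -E mulgK.
    by apply: inPM (inPV uK); apply: inPM uK (inP_sgi _ _); rewrite inE.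
  by move/inP_sg; rewrite inE (negPf xN).
have uK' : inP (x0 |: [set z in y :: p]) u by apply: inP_mono (subsetUr _ _) uK.
have : inP (x0 |: [set z in y :: p]) (sg j : W).
  have -> : sg j = (u^-1 * (sg x0 * u))%g by rewrite E mulKg.
  by apply: inPM (inPV uK') _; apply: inPM (inP_sgi _ _) uK'; rewrite !inE eqxx.
by move/inP_sg; rewrite in_setU1 (negPf jx) inE (negPf jp).
Qed.

End Transfer.

(** * Pairs of parabolic subgroups and index sets *)

Section ParabolicPairs.
Variables (n : nat) (W : coxSys n).
Implicit Types (g u v : W) (P X Y Q J : {set 'I_n}).
Local Open Scope group_scope.

Lemma inP_desc J g j : inP J g -> ~~ pos g j -> j \in J.
Proof.
move=> Jg npg; apply: (@inP_sg _ W).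
rewrite -(mulKg g (sg j)); apply: inPM (inPV Jg) _.
exact: inP_ble Jg (ble_sgN npg).
Qed.

Lemma pos_sg i j : j != i -> pos (sg i : W) j.
Proof.
move=> ji; apply/negPn/negP => /(inP_desc (inP_sgi W (set11 i))).
by rewrite inE (negPf ji).
Qed.

(** [mr X (wl W P)] is the Bruhat maximum of the elements of W_P in W^X, and W_Y is closed
    downwards. *)
Lemma mr_wlP P X Y : inP Y (mr X (wl W P)) <-> (forall g, inP P g -> isup X g -> inP Y g).
Proof.
split=> [Yv g Pg Xg|]; last by apply; [exact: inP_ble (wl_in W P) (mr_ble _ _)|exact: isup_mr].
by apply: inP_ble Yv _; apply: isup_ble_mr Xg (ble_wl Pg).
Qed.

(** Both sides are Bruhat maxima. If the left one lies in W_Y, it competes for the right one;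
    conversely the right one is in W^X, because a descent of an element of W_Y lies in Y, and a
    descent in X would lie in the intersection of X and Y. *)
Lemma mr_wl_eqP P X Y : X \subset P -> Y \subset P ->
  mr X (wl W P) = mr (X :&: Y) (wl W Y) <-> inP Y (mr X (wl W P)).
Proof.
move=> XP YP; split=> [->|Ya].
  exact: inP_ble (wl_in W Y) (mr_ble _ _).
apply: ble_anti.
  apply: isup_ble_mr (ble_wl Ya).
  by apply: isup_mono (isup_mr X _); exact: subsetIl.
have Yb : inP Y (mr (X :&: Y) (wl W Y)) by exact: inP_ble (wl_in W Y) (mr_ble _ _).
apply: isup_ble_mr; last exact/ble_wl/(inP_mono YP).
apply/isupP => j jX; apply/negPn/negP => npb.
have jY := inP_desc Yb npb.
have /isupP/(_ j) := isup_mr (X :&: Y) (wl W Y).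
by rewrite inE jX jY (negPf npb) => /(_ isT).
Qed.

End ParabolicPairs.

Section DynkinPairs.
Variables (n : nat) (A : 'M[int]_n) (hA : finite_type_cartan A).
Notation W := (coxW hA).
Variables (P X Y : {set 'I_n}).
Hypotheses (XP : X \subset P) (YP : Y \subset P).

Definition path_cond := X :|: Y = P /\ forall (x : 'I_n) (p : seq 'I_n),
  path (dynkin_adj A) x p -> uniq (x :: p) -> x \in X :\: Y -> last x p \in Y :\: X ->
  has (fun v => v \notin P) (x :: p).

(** For a path inside P, the product of its reflections has at most its last vertex as a descent.
    That vertex is outside X, so the product is in W^X, hence in W_Y, which puts the first vertex in
    Y. For the union, s_k with k in P outside X plays the same role. *)
Lemma path_cond_of_inP : (forall g : W, inP P g -> isup X g -> inP Y g) -> path_cond.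
Proof.
move=> H; split.
  apply/eqP; rewrite eqEsubset subUset XP YP /=; apply/subsetP => k kP.
  rewrite inE; have [//|kX] := boolP (k \in X); rewrite /=.
  apply: (@inP_sg _ W); apply: H; first exact: inP_sgi.
  apply/isupP => j jX; apply: pos_sg; apply: contraNneq kX => <- //.
move=> x p xp up; rewrite !inE => /andP[xY xX] /andP[lX lY].
apply/negPn/negP => /hasPn pP.
have pP' z : z \in x :: p -> z \in P by move/pP; rewrite negbK.
pose g := wp W (x :: p).
have Yg : inP Y g.
  apply: H; first by exists (x :: p) => //; apply/allP.
  apply/isupP => j jX; apply: path_desc => //.
  by apply: contraNneq lX => <-.
(* The first vertex occurs in a reduced subword of the path, since otherwise s_x would be a product
   of reflections at the remaining vertices. *)
have [t [st rt tE]] := reduced_sub W (x :: p).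
case/negP: xY; apply: (@inP_sg _ W).
have [xt|xt] := boolP (x \in t).
  by apply: inP_ble Yg _; rewrite /g -tE -wp1; apply: subword_ble; rewrite // sub1seq.
have inp w : {subset w <= p} -> inP [set z in p] (wp W w).
  by move=> wp'; exists w => //; apply/allP => z /wp'; rewrite inE.
have : inP [set z in p] (sg x : W).
  have -> : sg x = (g * (wp W p)^-1)%g by rewrite /g wp_cons mulgK.
  apply: inPM; last by apply: inPV; apply: inp.
  rewrite /g -tE; apply: inp => z zt; have := mem_subseq st zt.
  by rewrite inE => /predU1P[zx|//]; rewrite -zx zt in xt.
by move/inP_sg; rewrite inE => xp'; case/andP: up; rewrite xp'.
Qed.

(* P splits into P1, the union of the components meeting X \ Y, and the rest P2, with P1 in X,
   P2 in Y, and commuting parabolic subgroups. *)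
Lemma inP_of_path_cond : path_cond -> forall g : W, inP P g -> isup X g -> inP Y g.
Proof.
move=> [XYP H].
pose e i j := [&& dynkin_adj A i j, i \in P & j \in P].
pose P1 := [set k in P | [exists x in X :\: Y, connect e x k]].
pose P2 := P :\: P1.
have P1X : P1 \subset X.
  apply/subsetP => k; rewrite inE => /andP[kP /exists_inP[x xXY /connectP[p ep kl]]].
  apply/negPn/negP => kX.
  have kY : k \in Y by move: kP; rewrite -XYP inE (negPf kX).
  case/shortenP: ep kl => p' ep' up' _ kl.
  have pp : path (dynkin_adj A) x p' by apply: sub_path ep' => a b /and3P[].
  have lp : last x p' \in Y :\: X by rewrite -kl inE kX kY.
  have /hasP[v] := H x p' pp up' xXY lp.
  rewrite inE => /predU1P[->|vp]; first by move: xXY; rewrite inE => /andP[_ /(subsetP XP)->].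
  have : all [in P] p'.
    elim: (p') (x) ep' => //= b q IH a /andP[/and3P[_ _ ->] /IH]; exact.
  by move/allP/(_ v vp) => ->.
have P2Y : P2 \subset Y.
  apply/subsetP => k; rewrite inE => /andP[kP1 kP].
  apply/negPn/negP => kY; case/negP: kP1; rewrite inE kP; apply/exists_inP; exists k => //.
  by rewrite inE kY /=; move: kP; rewrite -XYP inE (negPf kY) orbF.
have comm i j : i \in P1 -> j \in P2 -> (sg i * sg j = sg j * sg i :> W)%g.
  move=> iP1 jP2; have ij : i != j by apply: contraTneq jP2 => <-; rewrite inE iP1.
  apply: sg_comm => //; apply/eqP/negPn/negP => Aij.
  move: jP2; rewrite !inE; case/andP => /negP jP1 jP; apply: jP1; rewrite jP /=.
  move: iP1; rewrite inE => /andP[iP /exists_inP[x xXY xi]].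
  apply/exists_inP; exists x => //; apply: connect_trans xi (connect1 _).
  by rewrite /e /dynkin_adj ij Aij iP jP.
have comm' i (g : W) : i \in P1 -> inP P2 g -> (sg i * g = g * sg i)%g.
  move=> iP1 [w + <-]; elim: w => [_|j w IH /andP[jP2 /IH E]]; first by rewrite wp_nil mulg1 mul1g.
  by rewrite wp_cons mulgA comm // -mulgA E mulgA.
have split_P (g : W) : inP P g -> exists g2 g1, [/\ inP P2 g2, inP P1 g1 & g = (g2 * g1)%g].
  move=> [w + <-]; elim: w => [_|i w IH /andP[iP /IH[g2 [g1 [h2 h1 E]]]]].
    by exists 1%g, 1%g; rewrite mulg1 wp_nil; split=> //; exact: inP1.
  have [iP1|iP1] := boolP (i \in P1).
    exists g2, (sg i * g1)%g; split=> //; first by apply: inPM h1; exact: inP_sgi.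
    by rewrite wp_cons E !mulgA comm'.
  exists (sg i * g2)%g, g1; split=> //; last by rewrite wp_cons E mulgA.
  by apply: inPM h2; apply: inP_sgi; rewrite inE iP1.
move=> g /split_P[g2 [g1 [h2 h1 E]]] Xg.
(* As g1 lies in W_X, g is the minimal representative of g2 W_X and so lies below g2. *)
apply: inP_ble (inP_mono P2Y h2) _.
by rewrite -(mr_id Xg) E (mr_inP _ (inP_mono P1X h1)); exact: mr_ble.
Qed.

End DynkinPairs.

(** * Index sets and their parabolic subgroups *)

Section IndexSets.
Variables (n : nat) (A : 'M[int]_n) (hA : finite_type_cartan A).
Variables (m : nat) (lam : 'I_m -> 'cV[int]_n) (Icol : {set {set 'I_m}}).
Hypothesis hdom : dominant lam.
Implicit Types (I J K : {set 'I_m}) (k : 'I_n) (c : seq {set 'I_m}).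

Notation P := (DP A lam Icol).
Notation X := (DQI A lam Icol).
Notation Y := (DQr A lam Icol).
Notation Q := (DQ A lam).

Lemma stabsetE (v : 'cV[int]_n) k : (k \in stabset A v) = (v k 0 == 0).
Proof.
rewrite inE sref_mul; apply/eqP/eqP => [|->]; last by rewrite scale0r subr0.
have E : (v - v k 0 *: alpha A k) k 0 = v k 0 - v k 0 * alpha A k k 0 by rewrite [LHS]mxE; congr (_ + _); rewrite [LHS]mxE; congr (- _); rewrite [LHS]mxE.
move/matrixP/(_ k 0); rewrite E alphaE; case: (hA) => -> _ _ _; move: (v k 0) => a; lia.
Qed.

Lemma DP_P I k : reflect (forall i, i \in ubar Icol I -> lam i k 0 = 0) (k \in P I).
Proof.
rewrite stabsetE summxE psumr_eq0; last by move=> i _; exact: hdom.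
by apply: (iffP allP) => H i; [move=> iI; apply/eqP; have := H i; rewrite mem_index_enum iI; apply |
  move=> _; apply/implyP => /H ->].
Qed.

Lemma DQ_P k : reflect (forall i, lam i k 0 = 0) (k \in Q).
Proof.
rewrite stabsetE summxE psumr_eq0; last by move=> i _; exact: hdom.
by apply: (iffP allP) => H i; [apply/eqP; have := H i; rewrite mem_index_enum; apply | rewrite H].
Qed.

Lemma ubar_sub I : ubar Icol I \subset I.
Proof.
rewrite /ubar; case: ifP => // _; apply/bigcupsP => K _; exact: subsetDl.
Qed.

Lemma cover_above K I : K \in Icol -> I \in Icol -> K \proper I ->
  exists2 L : {set 'I_m}, K \subset L & covers Icol L I.
Proof.
move=> KI II KpI.
pose R (L : {set 'I_m}) := [&& L \in Icol, K \subset L & L \proper I].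
have RK : R K by rewrite /R KI subxx KpI.
case: (@arg_maxnP _ K R (fun L => #|L|) RK) => L /and3P[LI KL LpI] Lmax.
exists L => //; rewrite /covers LI II LpI /=; apply/forall_inP => M MI.
apply/negP => /andP[LM MpI]; have := Lmax M; rewrite /R MI (subset_trans KL (proper_sub LM)) MpI.
by move/(_ isT); rewrite /= leqNgt (proper_card LM).
Qed.

Lemma cover_below J I : J \in Icol -> I \in Icol -> J \proper I ->
  exists2 L : {set 'I_m}, L \subset I & covers Icol J L.
Proof.
move=> JI II JpI.
pose R (L : {set 'I_m}) := [&& L \in Icol, L \subset I & J \proper L].
have RI : R I by rewrite /R II subxx JpI.
case: (@arg_minnP _ I R (fun L => #|L|) RI) => L /and3P[LI LsI JL] Lmin.
exists L => //; rewrite /covers LI JI JL /=; apply/forall_inP => M MI.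
apply/negP => /andP[JM ML]; have := Lmin M; rewrite /R MI (subset_trans (proper_sub ML) LsI) JM.
by move/(_ isT); rewrite /= leqNgt (proper_card ML).
Qed.

Lemma ubar_cover J I : covers Icol J I -> I :\: J \subset ubar Icol I.
Proof.
move=> JI; have /and4P[Jc Ic Jp _] := JI; rewrite /ubar ifT; last first.
  by apply/exists_inP; exists J.
by apply: (bigcup_max J); rewrite ?Jc.
Qed.

(** Descend along covers: at the step where i drops out it belongs to [ubar], and if it never does,
    it survives to a minimal set, which is its own [ubar]. *)
Lemma ubar_exhaust I i : I \in Icol -> i \in I ->
  exists J, [/\ J \in Icol, J \subset I & i \in ubar Icol J].
Proof.
elim: {I}#|I| {-2}I (leqnn #|I|) => [|k IH] I cI Ic iI.
  by move: cI; rewrite leqn0 cards_eq0 => /eqP I0; rewrite I0 inE in iI.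
have [iu|iu] := boolP (i \in ubar Icol I); first by exists I.
have [/exists_inP[K0 K0c K0p]|no] := boolP [exists K in Icol, K \proper I]; last first.
  by move: iu; rewrite /ubar (negPf no) iI.
have [K _ cK] := cover_above K0c Ic K0p; have /and4P[Kc _ Kp _] := cK.
have iK : i \in K.
  apply/negPn/negP => iK; case/negP: iu; apply: (subsetP (ubar_cover cK)).
  by rewrite inE iK iI.
have [|J [Jc JK iJ]] := IH K _ Kc iK.
  by rewrite -ltnS; apply: leq_trans (proper_card Kp) cI.
by exists J; split=> //; apply: subset_trans JK (proper_sub Kp).
Qed.

(** Intersecting over all J below I replaces [ubar] by I itself: Q_I fixes every weight indexed by
    I. *)
Lemma DQI_P I k : I \in Icol -> reflect (forall i, i \in I -> lam i k 0 = 0) (k \in X I).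
Proof.
move=> Ic; apply: (iffP bigcapP) => [H i iI|H J /andP[Jc JI]].
  have [J [Jc JI iJ]] := ubar_exhaust Ic iI.
  have /DP_P kJ : k \in P J by apply: H; rewrite Jc JI.
  exact: kJ.
apply/DP_P => i iJ; apply: H; apply: (subsetP JI); exact: (subsetP (ubar_sub J)).
Qed.

Lemma DQI_DP I : I \in Icol -> X I \subset P I.
Proof. by move=> Ic; apply: bigcap_inf; rewrite Ic subxx. Qed.

Lemma DQ_DQI I : I \in Icol -> Q \subset X I.
Proof. by move=> Ic; apply/subsetP => k /DQ_P H; apply/DQI_P => // i _; exact: H. Qed.

Lemma DQ_DP I : I \in Icol -> Q \subset P I.
Proof. by move=> Ic; apply: subset_trans (DQ_DQI Ic) (DQI_DP Ic). Qed.

Lemma DQI_mono J I : J \subset I -> X I \subset X J.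
Proof.
move=> JI; apply/bigcapsP => K /andP[Kc KJ]; apply: bigcap_inf.
by rewrite Kc (subset_trans KJ JI).
Qed.

(** [ubar] of I contains I \ J, so P_I supplies what Q_J misses. This is the recursion by which
    cosets modulo W_{Q_I} are controlled up a chain. *)
Lemma DQI_cover J I : covers Icol J I -> X I = X J :&: P I.
Proof.
move=> cJ; have /and4P[Jc Ic Jp _] := cJ; apply/setP => k; rewrite inE.
apply/DQI_P/andP => // [H|[/(DQI_P _ Jc) HJ /DP_P HI] i iI].
  split; first by apply/DQI_P => // i /(subsetP (proper_sub Jp)); exact: H.
  by apply/DP_P => i /(subsetP (ubar_sub I)); exact: H.
have [/HJ //|iJ] := boolP (i \in J).
by apply: HI; apply: (subsetP (ubar_cover cJ)); rewrite inE iJ.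
Qed.

Lemma DQI_min I : I \in Icol -> ~~ [exists K in Icol, K \proper I] -> X I = P I.
Proof.
move=> Ic no; apply/setP => k; apply/DQI_P/DP_P => // H i.
  by move/(subsetP (ubar_sub I)); exact: H.
by move=> iI; apply: H; rewrite /ubar (negPf no).
Qed.

Lemma DQr_P I c k : reflect (forall J, J \in I :: c -> k \in P J) (k \in Y I c).
Proof.
rewrite /DQr; elim: (I :: c) => [|J s IH]; first by rewrite big_nil inE; apply: ReflectT.
rewrite big_cons inE; apply: (iffP andP) => [[kJ /IH H] L|H].
  by rewrite inE => /predU1P[->|/H].
by split; [apply: H; rewrite mem_head|apply/IH => L Ls; apply: H; rewrite inE Ls orbT].
Qed.

Lemma DQr_sub I c J : J \in I :: c -> Y I c \subset P J.
Proof. by move=> JI; apply/subsetP => k /DQr_P; apply. Qed.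

Lemma DQr_cons I J c : Y I (J :: c) = P I :&: Y J c.
Proof. by rewrite /DQr big_cons. Qed.

(** I takes care of the weights indexed by I, and each cover of I by J on the chain of those indexed
    by J \ I; the chain ends at the full set. *)
Lemma DQI_DQr I c : cover_chain Icol I c -> X I :&: Y I c = Q.
Proof.
move=> /and3P[Ic pc /eqP lc]; apply/setP => k; rewrite inE.
apply/andP/DQ_P => [[/(DQI_P _ Ic) HI /DQr_P HY] i|H]; last first.
  split; first by apply/DQI_P => // i _; exact: H.
  by apply/DQr_P => J _; apply/DP_P => i _; exact: H.
suff : forall i, i \in last I c -> lam i k 0 = 0 by apply; rewrite lc inE.
elim: c I {Ic lc} pc HI HY => [//|J c IH] I /= /andP[IJ pc] HI HY.
apply: IH pc _ _ => [j jJ|L Lc]; last by apply: HY; rewrite inE Lc orbT.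
have [/HI //|jI] := boolP (j \in I).
have /DP_P kJ : k \in P J by apply: HY; rewrite !inE eqxx orbT.
by apply: kJ; apply: (subsetP (ubar_cover IJ)); rewrite inE jI.
Qed.

Lemma cover_path J I : J \in Icol -> I \in Icol -> J \subset I ->
  exists2 c, path (covers Icol) J c & last J c = I.
Proof.
move=> + Ic; elim: {J}(#|I| - #|J|)%N {-2}J (leqnn (#|I| - #|J|)%N) => [|k IH] J ck Jc JI;
  have [<-|JnI] := eqVneq J I; try by exists [::].
all: have JpI : J \proper I by rewrite properEneq JnI.
  by have := proper_card JpI; lia.
have [L LI cL] := cover_below Jc Ic JpI; have /and4P[_ Lc JpL _] := cL.
have [|c pc lc] := IH L _ Lc LI.
  by have := proper_card JpL; have := proper_card JpI; lia.
by exists (L :: c) => //=; rewrite cL.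
Qed.

Lemma cover_chain_through J I : [set: 'I_m] \in Icol -> J \in Icol -> I \in Icol -> J \subset I ->
  exists2 c, cover_chain Icol J c & I \in J :: c.
Proof.
move=> IT Jc Ic JI; have [c1 p1 l1] := cover_path Jc Ic JI.
have [c2 p2 l2] := cover_path Ic IT (subsetT I).
exists (c1 ++ c2); first by rewrite /cover_chain Jc cat_path p1 last_cat l1 p2 l2 eqxx.
by rewrite -cat_cons mem_cat -{1}l1 mem_last.
Qed.

Notation W := (coxW hA).

(* The longest element of W_{P_I} cap W^{Q_I}. *)
Definition vI I : W := mr (X I) (wl W (P I)).

Definition lift_cond := forall I c, cover_chain Icol I c -> inP (Y I c) (vI I).

Lemma cover_chain_in I c : cover_chain Icol I c -> I \in Icol. Proof. by case/and3P. Qed.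

Lemma extremal_lift_cond : (forall I c, cover_chain Icol I c ->
      minpre A Q (X I) (maxpre A (X I) (P I) 1%:M)
      = maxpre A Q (Y I c) (minpre A (Y I c) (P I) 1%:M)) <-> lift_cond.
Proof.
have E I c : cover_chain Icol I c ->
    (minpre A Q (X I) (maxpre A (X I) (P I) 1%:M)
      = maxpre A Q (Y I c) (minpre A (Y I c) (P I) 1%:M)) <-> inP (Y I c) (vI I).
  move=> cI; have Ic := cover_chain_in cI.
  have YP : Y I c \subset P I by apply: DQr_sub; rewrite mem_head.
  have QY : Q \subset Y I c by rewrite -(DQI_DQr cI) subsetIr.
  rewrite -(wmx1 hA) maxpre_wmx ?DQI_DP // minpre_wmx ?DQ_DQI //.
  rewrite minpre_wmx // maxpre_wmx //.
  have m1 (J : {set 'I_n}) : mr J (1%g : W) = 1%g by apply: mr_id; exact: isup1.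
  have x1 (J : {set 'I_n}) : mx J (1%g : W) = wl W J by rewrite /mx m1 mul1g.
  rewrite m1 !x1 (mr_id (isup_mr _ _)).
  have := @mr_wl_eqP _ W _ _ _ (DQI_DP Ic) YP; rewrite DQI_DQr // /vI => <-.
  by split=> [/wmx_inj|->].
by split=> H I c cI; apply/E => //; exact: H.
Qed.

Lemma parabolic_lift_cond : (forall I c, cover_chain Icol I c ->
      forall w, inWJ A (P I) w -> inWup A (X I) w -> inWJ A (Y I c) w /\ inWup A Q w) <-> lift_cond.
Proof.
split=> H I c cI.
  apply/mr_wlP => g Pg Xg; apply/inWJ_wmx.
  by have [] := H I c cI (wmx g); [exact/inWJ_wmx|exact/inWup_wmx|].
have Ic := cover_chain_in cI.
move=> w /(inWJ_ex hA)[g -> Pg] /inWup_wmx Xg; split.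
  by apply/inWJ_wmx; have /mr_wlP := H I c cI; apply.
by apply/inWup_wmx; apply: isup_mono Xg; exact: DQ_DQI.
Qed.

Lemma path_lift_cond : (forall I c, cover_chain Icol I c -> path_cond A (P I) (X I) (Y I c)) <-> lift_cond.
Proof.
split=> H I c cI; have Ic := cover_chain_in cI;
  have YP : Y I c \subset P I by apply: DQr_sub; rewrite mem_head.
  apply/mr_wlP; apply: inP_of_path_cond (H I c cI) => //; exact: DQI_DP.
apply: (path_cond_of_inP (hA := hA)) => //; first exact: DQI_DP.
by apply/mr_wlP; exact: H.
Qed.

End IndexSets.

(** * Standard chains *)

Section Chains.
Variables (n : nat) (A : 'M[int]_n) (hA : finite_type_cartan A).
Variables (m : nat) (lam : 'I_m -> 'cV[int]_n) (Icol : {set {set 'I_m}}).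
Hypotheses (hdom : dominant lam) (IT : [set: 'I_m] \in Icol).
Implicit Types (I J K : {set 'I_m}) (k : 'I_n) (c d s : seq {set 'I_m}).
Implicit Types (x y z : Elt n m) (C D : seq (Elt n m)).

Notation P := (DP A lam Icol).
Notation X := (DQI A lam Icol).
Notation Y := (DQr A lam Icol).
Notation Q := (DQ A lam).
Notation W := (coxW hA).
Notation tau := (minrep A Q (w0 A)).
Notation inWl := (inWl A lam Icol tau).
Notation inWbar := (inWbar A lam Icol tau).
Notation basebar := (basebar A lam Icol tau).
Notation gebar := (gebar A lam Icol tau).
Notation leW := (@leW n A m).
Notation rho := (rho A lam Icol).
Notation barchain := (barchain A lam Icol tau).
Notation defchain := (defchain A lam Icol tau).
Notation tstd_chain := (tstd_chain A lam Icol tau).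
Notation max_tstd_chain := (max_tstd_chain A lam Icol tau).
Notation inD := (inD A lam Icol tau).
Notation geD := (geD A lam Icol tau).
Notation vI := (vI hA lam Icol).
Implicit Types (g h u : W).

Lemma tau_wmx : tau = wmx (mr Q (wl W setT)).
Proof. by rewrite (w0_wmx hA) minrep_wmx. Qed.

Lemma inWl_wmx I g : I \in Icol -> isup Q g -> inWl (wmx g, I).
Proof.
move=> Ic up; split=> //=; first exact/inWup_wmx.
by rewrite tau_wmx; apply/bruhat_wmx; apply: isup_ble_mr up (ble_top _).
Qed.

Lemma inWl_ex x : inWl x -> exists g I, [/\ x = (wmx g, I), isup Q g & I \in Icol].
Proof. by case: x => x I [/= /(inWup_ex hA)[g -> up] _ Ic]; exists g, I. Qed.

Lemma inWbar_wmx I g : I \in Icol -> isup (P I) g -> inWbar (wmx g, I).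
Proof.
move=> Ic up; split=> //=; first exact/inWup_wmx.
rewrite tau_wmx minrep_wmx mr_mr ?DQ_DP //.
by apply/bruhat_wmx; apply: isup_ble_mr up (ble_top _).
Qed.

Lemma inWbar_ex z : inWbar z -> exists g I, [/\ z = (wmx g, I), isup (P I) g & I \in Icol].
Proof. by case: z => x I [/= /(inWup_ex hA)[g -> up] _ Ic]; exists g, I. Qed.

Lemma leW_wmx g h I J : leW (wmx g, I) (wmx h, J) <-> ble g h /\ I \subset J.
Proof. by split=> -[/= /bruhat_wmx]. Qed.

Lemma leW_anti x y : inWl x -> inWl y -> leW x y -> leW y x -> x = y.
Proof.
move=> /inWl_ex[g [I [-> _ _]]] /inWl_ex[h [J [-> _ _]]].
move=> /leW_wmx[gh IJ] /leW_wmx[hg JI].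
by rewrite (ble_anti gh hg); congr (_, _); apply/eqP; rewrite eqEsubset IJ.
Qed.

Lemma basebar_wmx g h I J : I \in Icol -> J \in Icol -> isup (P I) g -> isup (P J) h ->
  basebar (wmx g, I) (wmx h, J) <-> J \subset I /\ ble h (mx (P I) g).
Proof.
move=> Ic Jc ug uh; rewrite /basebar /= minpre_wmx ?DQ_DP // maxpre_wmx ?DQ_DP //.
rewrite (mr_id uh); split=> [[_ _ JI /bruhat_wmx le]|[JI le]].
  by split=> //; apply: ble_trans le (mr_ble _ _).
split=> //; try exact: inWbar_wmx.
apply/bruhat_wmx; apply: isup_ble_mr le; apply: isup_mono uh; exact: DQ_DP.
Qed.

Lemma rho_wmx g I : rho (wmx g, I) = (wmx (mr (P I) g), I).
Proof. by rewrite /rho /= minrep_wmx. Qed.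

Lemma inWbar_rho x : inWl x -> inWbar (rho x).
Proof.
by move=> /inWl_ex[g [I [-> _ Ic]]]; rewrite rho_wmx; apply: inWbar_wmx (isup_mr _ _).
Qed.

Lemma mx_mr (L : {set 'I_n}) g : mx L (mr L g) = mx L g.
Proof. by apply: mx_eq; exact: mr_in'. Qed.

Lemma basebar_rho x y : inWl x -> inWl y -> leW y x -> basebar (rho x) (rho y).
Proof.
move=> /inWl_ex[g [I [-> _ Ic]]] /inWl_ex[h [J [-> _ Jc]]] /leW_wmx[hg JI].
rewrite !rho_wmx; apply/basebar_wmx => //; try exact: isup_mr.
split=> //; rewrite mx_mr; apply: ble_trans (mr_ble _ _) _.
exact: ble_trans hg (ble_mx_self _ _).
Qed.

Lemma gebar_rho x y : inWl x -> inWl y -> leW y x -> gebar (rho x) (rho y).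
Proof. by move=> *; apply: Relation_Operators.t_step; exact: basebar_rho. Qed.

Lemma gebar_props x y : gebar x y -> [/\ inWbar x, inWbar y & y.2 \subset x.2].
Proof.
elim=> {x y} [x y [Wx Wy yx _]|x y z _ [Wx _ yx] _ [_ Wz zy]] //.
by split=> //; apply: subset_trans zy yx.
Qed.

Lemma gebar_trans y x z : gebar x y -> gebar y z -> gebar x z.
Proof. exact: Relation_Operators.t_trans. Qed.

Lemma sdec_pairwise (ge : Elt n m -> Elt n m -> Prop) (s : seq (Elt n m)) :
  sdec ge s <-> pairwise (fun x y => `[< ge x y /\ x <> y >]) s.
Proof.
split=> [H|/(pairwiseP (elt0 n m)) H i j /andP[ij js]].
  by apply/(pairwiseP (elt0 n m)) => i j _ js ij; apply/asboolP; apply: H; rewrite ij.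
apply/asboolP; apply: H => //; rewrite inE; exact: ltn_trans ij js.
Qed.

Lemma sdec_uniq ge (s : seq (Elt n m)) : sdec ge s -> uniq s.
Proof.
move=> H; apply/(uniqP (elt0 n m)) => i j; rewrite !inE => si sj E.
case: (ltngtP i j) => // ij.
  by have [|_ /(_ E)] := H i j; rewrite ?ij.
by have [|_ /(_ (esym E))] := H j i; rewrite ?ij.
Qed.

Lemma inWbar_finite : exists U : seq (Elt n m), forall z, inWbar z -> z \in U.
Proof.
have [N hN] := wprod_word_bound hA.
exists (allpairs (fun (b : N.-bseq 'I_n) (I : {set 'I_m}) => (wprod A b, I) : Elt n m)
  (enum {: N.-bseq 'I_n}) (enum {: {set 'I_m}})).
move=> z /inWbar_ex[g [I [-> _ _]]].
have [w wE] := wv_word g; have [r rN rE] := hN w.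
apply/allpairsP; exists (Bseq rN, I) => /=; split; rewrite ?mem_enum //.
by rewrite rE wE.
Qed.

Lemma tstd_extend C : tstd_chain C -> exists2 C', max_tstd_chain C' & {subset C <= C'}.
Proof.
have [U hU] := inWbar_finite => tC.
have bound C' : tstd_chain C' -> (size C' <= size U)%N.
  move=> [[CW /sdec_uniq uC] _]; apply: uniq_leq_size uC _ => z /CW; exact: hU.
elim: {C}(size U - size C)%N {-2}C (leqnn (size U - size C)%N) tC => [|k IH] C ck tC;
  have [mC|nmC] := pselect (forall C', tstd_chain C' -> {subset C <= C'} -> {subset C' <= C});
  try by exists C.
all: have [C' [tC' [CC' nC]]] : exists C', tstd_chain C' /\ {subset C <= C'} /\ ~ {subset C' <= C} by
  apply: contrapT => no; apply: nmC => C' tC' CC'; apply: contrapT => nn; apply: no; exists C'.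
all: have lt : (size C < size C')%N by
  rewrite ltnNge; apply/negP => le; apply: nC => z zC';
  have [[_ /sdec_uniq uC] _] := tC;
  by have [_ ->] := uniq_min_size uC CC' le.
all: have le := bound _ tC'.
  by move: ck lt le; lia.
have [|C'' mC'' sub] := IH C' _ tC'; first by move: ck lt le; lia.
by exists C'' => // z /CC' /sub.
Qed.

Definition liftof C D x := nth (elt0 n m) D (index x C).

Lemma liftofP C D x : defchain C D -> x \in C ->
  [/\ liftof C D x \in D, inWl (liftof C D x) & rho (liftof C D x) = x].
Proof.
move=> [szD DW _ CD] xC; have lt : (index x C < size C)%N by rewrite index_mem.
have LD : liftof C D x \in D by rewrite mem_nth ?szD.
split=> //; first exact: DW.
have [E1 E2] := CD _ lt; rewrite nth_index // in E1 E2.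
by rewrite /rho /liftof E1 E2 -surjective_pairing.
Qed.

(** Chains are lists, so positions must be recovered: if y preceded x, its index set would contain
    that of x. *)
Lemma liftof_le C D x y : barchain C -> defchain C D -> x \in C -> y \in C -> y.2 \proper x.2 ->
  leW (liftof C D y) (liftof C D x).
Proof.
move=> [_ dC] [szD DW dD _] xC yC yx.
have ix : (index x C < size C)%N by rewrite index_mem.
have iy : (index y C < size C)%N by rewrite index_mem.
case: (ltngtP (index x C) (index y C)) => [lt|gt|E].
- by have [|] := dD (index x C) (index y C); rewrite ?lt ?szD.
- have [|] := dC (index y C) (index x C); first by rewrite gt.
  rewrite !nth_index // => /gebar_props[_ _ xy]; move: yx.
  by rewrite properE xy andbF.
move: (nth_index (elt0 n m) xC); rewrite E nth_index // => xy.
by move: yx; rewrite xy properxx.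
Qed.

(** A constant first component gives a defining chain at once. It is used with u = 1 and with u the
    class of w_P. *)
Lemma const_chain u s : isup Q u -> all [in Icol] s ->
  pairwise (fun I J : {set 'I_m} => J \proper I) s ->
  tstd_chain [seq rho (wmx u, J) | J <- s].
Proof.
move=> up sI ps.
have Wl I : I \in s -> inWl (wmx u, I) by move=> /(allP sI) Is; apply: inWl_wmx.
have le I J : J \proper I -> leW (wmx u, J) (wmx u, I).
  by move=> /proper_sub JI; apply/leW_wmx; split=> //; exact: ble_refl.
have ne I J : J \proper I -> I <> J by move=> JI E; move: JI; rewrite E properxx.
split; last exists [seq (wmx u, J) | J <- s]; split.
- by move=> z /mapP[I Is ->]; apply: inWbar_rho; apply: Wl.
- apply/sdec_pairwise; rewrite pairwise_map; apply: (@sub_in_pairwise _ [in s] _ _ _ s _ ps) => [I J Is Js JI|]; last exact/allP.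
  apply/asboolP; split; first by apply: gebar_rho; [exact: Wl|exact: Wl|exact: le].
  by case=> _; exact: ne.
- by rewrite !size_map.
- by move=> z /mapP[I Is ->]; apply: Wl.
- apply/sdec_pairwise; rewrite pairwise_map; apply: (@sub_in_pairwise _ [in s] _ _ _ s _ ps) => [I J Is Js JI|]; last exact/allP.
  by apply/asboolP; split; [exact: le|case; exact: ne].
move=> i; rewrite size_map => si.
by rewrite (nth_map set0) // (nth_map set0).
Qed.

Lemma down_path I : I \in Icol -> exists d, [/\ path (fun J K => covers Icol K J) I d,
  all [in Icol] (I :: d) & ~~ [exists K in Icol, K \proper last I d]].
Proof.
elim: {I}#|I| {-2}I (leqnn #|I|) => [|k IH] I cI Ic;
  (have [/exists_inP[K0 K0c K0p]|no] := boolP [exists K in Icol, K \proper I];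
   last by exists [::]; rewrite /= Ic).
  by have := proper_card K0p; move: cI; lia.
have [K _ cK] := cover_above K0c Ic K0p; have /and4P[Kc _ Kp _] := cK.
have [|d [pd ad nd]] := IH K _ Kc; first by have := proper_card Kp; move: cI; lia.
by exists (K :: d); rewrite /= cK Ic.
Qed.

Lemma covers_proper J I : covers Icol J I -> J \proper I.
Proof. by case/and4P. Qed.

Lemma proper_pairwise (e : rel {set 'I_m}) I s :
  (forall J K, e J K -> K \proper J) -> path e I s ->
  pairwise (fun J K : {set 'I_m} => K \proper J) (I :: s).
Proof.
move=> eP ps; rewrite -sorted_pairwise.
  by apply: sub_path ps => J K; exact: eP.
by move=> J K L JK KL /=; apply: proper_trans KL JK.
Qed.

Lemma mr_eq1 (L : {set 'I_n}) g : mr L g = 1%g <-> inP L g.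
Proof.
have {1}<- : mr L (1%g : W) = 1%g by apply: mr_id; exact: isup1.
rewrite mrP mulg1; split=> [/inPV|]; last exact: inPV.
by rewrite invgK.
Qed.

Lemma path_Icol I c : I \in Icol -> path (covers Icol) I c -> all [in Icol] (I :: c).
Proof.
move=> Ic; rewrite /= Ic /=; elim: c I {Ic} => //= J c IH I /andP[/and4P[_ Jc _ _] /IH ->].
by rewrite Jc.
Qed.

Lemma DQr_nil I : Y I [::] = P I.
Proof. by rewrite /DQr big_cons big_nil setIT. Qed.

(** * Consequences of a unique lift of the identity coset *)

Section UniqueLift.
Variables (I : {set 'I_m}) (x0 : Elt n m).
Hypotheses (Ic : I \in Icol) (x0u : forall x, inD x /\ rho x = (1%:M, I) -> x0 = x).

(** The lift does not depend on the maximal chain or on its defining chain, so constraints from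
    different chains accumulate on [x0]. *)
Lemma lift_x0 C D : max_tstd_chain C -> defchain C D -> (1%:M, I) \in C ->
  liftof C D (1%:M, I) = x0.
Proof.
move=> mC dD xC; have [LD _ LE] := liftofP dD xC.
by apply/esym/x0u; split=> //; exists C, D.
Qed.

(* The chain of the cosets of w_P below (1, I) forces the lift of (1, I) to be maximal mod W_X. *)
Lemma unique_lift_max : exists g, [/\ x0 = (wmx g, I), inP (P I) g & mr (X I) g = vI I].
Proof.
have [d [pd ad nd]] := down_path Ic.
pose w := wl W (P I); pose t := mr Q w.
have pp := proper_pairwise (fun J K => @covers_proper K J) pd.
have [C mC sub] := tstd_extend (const_chain (isup_mr Q w) ad pp).
have [[bC [D dD]] _] := mC.
pose L J := liftof C D (rho (wmx t, J)).
have zC J : J \in I :: d -> rho (wmx t, J) \in C.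
  by move=> Jd; apply: sub; apply/mapP; exists J.
have LP J : J \in I :: d -> exists h, [/\ L J = (wmx h, J), isup Q h & mr (P J) h = mr (P J) w].
  move=> Jd; have Jc : J \in Icol := allP ad J Jd.
  have [_ /inWl_ex[h [J' [LE uh _]]] rE] := liftofP dD (zC J Jd).
  move: rE; rewrite -/(L J) in LE *; rewrite LE !rho_wmx => -[hE JE].
  exists h; split=> //; first by rewrite JE.
  by move: hE; rewrite JE => hE; rewrite (wmx_inj hE) /t mr_mr // DQ_DP.
have w1 : mr (P I) w = 1%g by apply/mr_eq1; exact: wl_in.
have [g [gE ug gw]] := LP I (mem_head _ _).
have gP : inP (P I) g by apply/mr_eq1; rewrite gw.
exists g; split=> //.
  have z1 : rho (wmx t, I) = (1%:M, I) by rewrite rho_wmx /t mr_mr ?DQ_DP // w1 wmx1.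
  by rewrite -gE /L z1 lift_x0 // -z1; apply: zC; rewrite mem_head.
(* g lies in W_{P_I}, which is closed downwards, so the lifts below it lie there too and are bounded
   by w. *)
have Lle K h : K \in I :: d -> L K = (wmx h, K) -> ble h w.
  move=> Kd LE; apply: ble_wl; apply: inP_ble gP _.
  move: Kd; rewrite inE => /predU1P[KI|Kd].
    by move: LE; rewrite KI gE => -[/wmx_inj ->]; exact: ble_refl.
  have KI : K \proper I by move: pp => /= /andP[/allP/(_ K Kd)].
  have := @liftof_le C D (rho (wmx t, I)) (rho (wmx t, K)) bC dD.
  rewrite -/(L I) -/(L K) gE LE => H.
  have zI : rho (wmx t, I) \in C by apply: zC; rewrite mem_head.
  have zK : rho (wmx t, K) \in C by apply: zC; rewrite inE Kd orbT.
  by have /leW_wmx[] := H zI zK KI.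
suff main d' K : path (fun J K => covers Icol K J) K d' -> {subset K :: d' <= I :: d} ->
    ~~ [exists K0 in Icol, K0 \proper last K d'] ->
    forall h, L K = (wmx h, K) -> mr (X K) h = mr (X K) w.
  by apply: (main d I) => //.
elim: d' K => [|J d' IH] K.
  move=> _ sK nK h LK; have Kd : K \in I :: d by apply: sK; rewrite inE.
  rewrite (DQI_min hA hdom (allP ad K Kd) nK).
  by have [h' [+ _ <-]] := LP K Kd; rewrite LK => -[/wmx_inj ->].
rewrite [path _ _ _]/= => /andP[cJK pd'] sK nK h LK.
have Kd : K \in I :: d by apply: sK; rewrite mem_head.
have Jd : J \in I :: d by apply: sK; rewrite !inE eqxx orbT.
have [h' [LJ _ _]] := LP J Jd.
have E' : mr (X J) h' = mr (X J) w.
  by apply: (IH J) => // M Md; apply: sK; rewrite inE Md orbT.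
have hh : ble h' h.
  have := @liftof_le C D (rho (wmx t, K)) (rho (wmx t, J)) bC dD (zC K Kd) (zC J Jd) (covers_proper cJK).
  by rewrite -/(L K) -/(L J) LK LJ => -[/bruhat_wmx].
(* Modulo W_{X_J}, h is squeezed between h' and w, which agree there by induction; modulo W_{P_K} it
   is prescribed by the chain. *)
have EX : mr (X J) h = mr (X J) w.
  apply: ble_anti; first by apply: ble_mr; exact: Lle LK.
  by rewrite -E'; exact: ble_mr.
rewrite (DQI_cover hA hdom cJK); apply: mrI => //.
by have [h'' [+ _ <-]] := LP K Kd; rewrite LK => -[/wmx_inj ->].
Qed.

(* The chain of the identity cosets above (1, I) forces the lift of (1, I) into W_Y. *)
Lemma unique_lift_min c g : cover_chain Icol I c -> x0 = (wmx g, I) -> inP (Y I c) g.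
Proof.
move=> /and3P[_ pc _] x0E; have ac := path_Icol Ic pc.
have pp : pairwise (fun J K : {set 'I_m} => K \proper J) (rev (I :: c)).
  rewrite -sorted_pairwise; last by move=> J K L JK KL /=; apply: proper_trans KL JK.
  by rewrite rev_sorted; apply: sub_path pc => J K; exact: covers_proper.
have ac' : all [in Icol] (rev (I :: c)) by rewrite all_rev.
have [C mC sub] := tstd_extend (const_chain (isup1 W Q) ac' pp).
have [[bC [D dD]] _] := mC.
have z1 J : rho (wmx (1%g : W), J) = (1%:M, J).
  by rewrite rho_wmx mr_id ?wmx1 //; exact: isup1.
pose L J := liftof C D (1%:M, J).
have zC J : J \in I :: c -> (1%:M, J) \in C.
  by move=> Jd; rewrite -z1; apply: sub; apply/mapP; exists J; rewrite ?mem_rev.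
have LP J : J \in I :: c -> exists2 h : W, L J = (wmx h, J) & inP (P J) h.
  move=> Jd; have [_ /inWl_ex[h [J' [LE uh _]]] rE] := liftofP dD (zC J Jd).
  move: rE; rewrite -/(L J) in LE *; rewrite LE rho_wmx -(wmx1 hA) => -[hE JE].
  exists h; first by rewrite JE.
  by apply/(mr_eq1 (P J) h); apply: (@wmx_inj _ _ hA); rewrite wmx1 -hE JE.
suff main c' K : path (covers Icol) K c' -> {subset K :: c' <= I :: c} ->
    forall h : W, L K = (wmx h, K) -> inP (Y K c') h.
  apply: (main c I) => //; rewrite -x0E; apply: lift_x0 => //.
  by apply: zC; rewrite mem_head.
have LP' J h : J \in I :: c -> L J = (wmx h, J) -> inP (P J) h.
  by move=> Jc LJ; have [h'] := LP J Jc; rewrite LJ => -[/wmx_inj <-].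
elim: c' K => [|J c' IH] K.
  by move=> _ sK h LK; rewrite DQr_nil; apply: LP' LK; apply: sK; rewrite inE.
rewrite [path _ _ _]/= => /andP[cKJ pc'] sK h LK.
have Kd : K \in I :: c by apply: sK; rewrite mem_head.
have Jd : J \in I :: c by apply: sK; rewrite !inE eqxx orbT.
have [h' LJ _] := LP J Jd.
rewrite DQr_cons; apply: inPI; first exact: LP' LK.
(* The induction runs from the top of the chain: h lies below h', so it inherits membership in W_Y
   for the part above J. *)
have Yh' : inP (Y J c') h'.
  by apply: (IH J) => // M Md; apply: sK; rewrite inE Md orbT.
apply: inP_ble Yh' _.
have := @liftof_le C D (1%:M, J) (1%:M, K) bC dD (zC J Jd) (zC K Kd) (covers_proper cKJ).
by rewrite -/(L K) -/(L J) LK LJ => -[/bruhat_wmx].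
Qed.

End UniqueLift.

Lemma unique_lift_cond : (forall I, I \in Icol ->
    exists! x, inD x /\ rho x = (1%:M, I)) -> lift_cond hA lam Icol.
Proof.
move=> H1 I c cI; have Ic := cover_chain_in cI.
have [x0 [_ x0u]] := H1 I Ic.
have [g [gE _ <-]] := unique_lift_max Ic x0u.
exact: inP_ble (unique_lift_min Ic x0u cI gE) (mr_ble _ _).
Qed.

(** * The canonical lift *)

Section Canonical.
Hypothesis H : lift_cond hA lam Icol.

(** Some cover chain from J passes through I, and its Q^r is contained in P_I; this is how
    [lift_cond] acts at every index set above J. *)
Lemma vI_in J I : J \in Icol -> I \in Icol -> J \subset I -> inP (P I) (vI J).
Proof.
move=> Jc Ic JI; have [c cJ Ic'] := cover_chain_through IT Jc Ic JI.
by apply: inP_mono (H cJ); apply: DQr_sub.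
Qed.

Lemma isup_vI I : isup (X I) (vI I). Proof. exact: isup_mr. Qed.

Lemma mr_mx_vI I g : I \in Icol -> isup (P I) g -> mr (X I) (mx (P I) g) = (g * vI I)%g.
Proof.
move=> Ic ug; have XP := DQI_DP A lam Ic.
rewrite -[RHS](mr_id (J := X I)).
  by apply/mrP; rewrite /mx (mr_id ug) invgM -mulgA mulKg; exact: mr_in.
by apply: isup_mulP ug (vI_in Ic Ic (subxx I)) XP (isup_vI I).
Qed.

Lemma mr_vI I g : I \in Icol -> isup (P I) g -> mr (P I) (g * vI I)%g = g.
Proof. by move=> Ic ug; rewrite mr_inP ?(mr_id ug) //; exact: vI_in. Qed.

Lemma ble_vI I g : I \in Icol -> isup (P I) g -> ble g (g * vI I)%g.
Proof. by move=> Ic ug; apply: ble_mulP ug _; exact: vI_in. Qed.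

Lemma ble_vI_mx I g : I \in Icol -> isup (P I) g -> ble (g * vI I)%g (mx (P I) g).
Proof. by move=> Ic ug; rewrite -mr_mx_vI //; exact: mr_ble. Qed.

(** The longest element of g W_{P_I} absorbs v_J, which lies in W_{P_I}. Projecting to W^{X_I} then
    replaces that longest element by g v_I and keeps h v_J, since X_I is contained in X_J. *)
Lemma ble_canonical g h I J : I \in Icol -> J \in Icol -> J \subset I ->
  isup (P I) g -> isup (P J) h ->
  ble h (mx (P I) g) <-> ble (h * vI J)%g (g * vI I)%g.
Proof.
move=> Ic Jc JI ug uh; split=> le; last first.
  by apply: ble_trans (ble_vI Jc uh) _; apply: ble_trans le (ble_vI_mx Ic ug).
rewrite -(mr_mx_vI Ic ug); apply: isup_ble_mr.
  by apply: isup_mono (DQI_mono _ _ _ JI) _; rewrite -mr_mx_vI //; exact: isup_mr.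
exact: long_ble (islong_mx _ _) le (vI_in Jc Ic JI).
Qed.

(** On [inWbar] this is (theta v, I) by [can_wmx]; the form with [maxpre] makes sense for all
    pairs. *)
Definition canonical_lift z : Elt n m := (maxpre A (X z.2) (P z.2) z.1, z.2).

Lemma can_wmx I g : I \in Icol -> isup (P I) g -> canonical_lift (wmx g, I) = (wmx (g * vI I)%g, I).
Proof. by move=> Ic ug; rewrite /canonical_lift /= maxpre_wmx ?DQI_DP // mr_mx_vI. Qed.

Lemma inWl_can z : inWbar z -> inWl (canonical_lift z).
Proof.
move=> /inWbar_ex[g [I [-> ug Ic]]]; rewrite can_wmx //; apply: inWl_wmx => //.
by rewrite -mr_mx_vI //; apply: isup_mono (isup_mr _ _); exact: DQ_DQI.
Qed.

Lemma rho_can z : inWbar z -> rho (canonical_lift z) = z.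
Proof. by move=> /inWbar_ex[g [I [-> ug Ic]]]; rewrite can_wmx // rho_wmx mr_vI. Qed.

Lemma basebar_can z y : inWbar z -> inWbar y -> basebar z y <-> leW (canonical_lift y) (canonical_lift z).
Proof.
move=> /inWbar_ex[g [I [-> ug Ic]]] /inWbar_ex[h [J [-> uh Jc]]].
rewrite !can_wmx // leW_wmx basebar_wmx //.
by split=> -[]; [move=> JI|move=> + JI] => /ble_canonical => E; split=> //; apply: E.
Qed.

Lemma leW_trans y x z : inWl x -> inWl y -> inWl z -> leW x y -> leW y z -> leW x z.
Proof.
move=> /inWl_ex[g [I [-> _ _]]] /inWl_ex[h [J [-> _ _]]] /inWl_ex[u [K [-> _ _]]].
move=> /leW_wmx[gh IJ] /leW_wmx[hu JK]; apply/leW_wmx.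
by split; [exact: ble_trans gh hu|exact: subset_trans IJ JK].
Qed.

(** By [basebar_can] the generating relation is pulled back from a transitive one, so the transitive
    closure adds nothing. *)
Lemma gebar_can z y : gebar z y <-> [/\ inWbar z, inWbar y & leW (canonical_lift y) (canonical_lift z)].
Proof.
split=> [|[Wz Wy /basebar_can]]; last by move=> b; apply: Relation_Operators.t_step; exact: b.
elim=> {z y} [z y b|z y x _ [Wz Wy yz] _ [_ Wx xy]].
  by case: (b) => Wz Wy _ _; split=> //; apply/basebar_can.
split=> //; apply: (leW_trans _ _ _ xy yz); exact: inWl_can.
Qed.

Lemma can_inj z y : inWbar z -> inWbar y -> canonical_lift z = canonical_lift y -> z = y.
Proof. by move=> Wz Wy E; rewrite -(rho_can Wz) E rho_can. Qed.

Lemma gebar_anti z y : gebar z y -> gebar y z -> z = y.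
Proof.
move=> /gebar_can[Wz Wy yz] /gebar_can[_ _ zy].
by apply: can_inj => //; apply: leW_anti; rewrite //; exact: inWl_can.
Qed.

Lemma gebar_refl z : inWbar z -> gebar z z.
Proof.
move=> Wz; apply/gebar_can; split=> //; have /inWl_ex[g [I [-> _ _]]] := inWl_can Wz.
by apply/leW_wmx; split=> //; exact: ble_refl.
Qed.

Lemma gebar_wmx g h I J : I \in Icol -> J \in Icol -> isup (P I) g -> isup (P J) h ->
  gebar (wmx g, I) (wmx h, J) <-> J \subset I /\ ble h (mx (P I) g).
Proof.
move=> Ic Jc ug uh; have Wg := inWbar_wmx Ic ug; have Wh := inWbar_wmx Jc uh.
by rewrite gebar_can -basebar_wmx // basebar_can //; split=> [[]|].
Qed.

Lemma barchain_can C : barchain C -> defchain C [seq canonical_lift z | z <- C].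
Proof.
move=> [CW dC]; split; first by rewrite size_map.
- by move=> x /mapP[z zC ->]; apply: inWl_can; apply: CW.
- apply/sdec_pairwise; rewrite pairwise_map; move/sdec_pairwise: dC => dC.
  apply: (@sub_in_pairwise _ [in C] _ _ _ C _ dC) => [x y xC yC|]; last exact/allP.
  move=> /asboolP[/gebar_can[Wx Wy le] ne]; apply/asboolP; split=> //.
  by move/can_inj => E; apply: ne; apply: E.
move=> i si; rewrite (nth_map (elt0 n m)) //.
have Wz := CW _ (mem_nth (elt0 n m) si).
by have := rho_can Wz; case: (nth _ _ _) => a b; rewrite /rho /= => -[E]; split.
Qed.

Lemma barchain_tstd C : barchain C -> tstd_chain C.
Proof. by move=> bC; split=> //; exists [seq canonical_lift z | z <- C]; exact: barchain_can. Qed.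

(** Under [lift_cond] every chain is standard, so an element comparable to all of C can be inserted
    after the elements above it. *)
Lemma max_chain_mem C z : max_tstd_chain C -> inWbar z ->
  (forall x, x \in C -> gebar x z \/ gebar z x) -> z \in C.
Proof.
move=> [[[CW dC] _] maxC] Wz cmp; apply: contrapT => zC.
pose p x := `[< gebar x z >].
pose C' := [seq x <- C | p x] ++ z :: [seq x <- C | ~~ p x].
have memC' x : x \in C' = (x \in C) || (x == z).
  by rewrite mem_cat inE !mem_filter; case: (p x); case: (x \in C); rewrite ?orbT ?orbF.
apply: (zC); apply: (maxC C'); last by rewrite memC' eqxx orbT.
  apply: barchain_tstd; split; first by move=> x; rewrite memC' => /orP[/CW|/eqP ->].
  move/sdec_pairwise: dC => dC; apply/sdec_pairwise.
  have zne x : x \in C -> x <> z by move=> xC E; apply: (zC); rewrite -E.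
  rewrite pairwise_cat allrel_consr /= !pairwise_filter // andbT.
  apply/and3P; split.
  - apply/andP; split.
      apply/allP => x; rewrite mem_filter => /andP[/asboolP px xC]; apply/asboolP.
      by split=> //; exact: zne.
    apply/allrelP => x y; rewrite !mem_filter => /andP[/asboolP px xC] /andP[/asboolP py yC].
    apply/asboolP; split; last by move=> E; apply: py; rewrite -E.
    by apply: gebar_trans px _; case: (cmp y yC).
  - by [].
  apply/allP => y; rewrite mem_filter => /andP[/asboolP py yC]; apply/asboolP.
  by split; [case: (cmp y yC)|move=> E; apply: (zne y)].
by move=> x xC; rewrite memC' xC.
Qed.

(** * Lifts in a maximal standard chain *)

Section MaximalChain.
Variables (C D : seq (Elt n m)).
Hypotheses (mC : max_tstd_chain C) (dD : defchain C D).

Let CW z : z \in C -> inWbar z. Proof. by case: mC => -[[H' _] _] _; exact: H'. Qed.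
Let dC : sdec gebar C. Proof. by case: mC => -[[_ H'] _] _. Qed.
Notation "C `_ i" := (nth (elt0 n m) C i).

Lemma chain_gebar i j : (i <= j)%N -> (j < size C)%N -> gebar C`_i C`_j.
Proof.
rewrite leq_eqVlt => /predU1P[->|ij] js; first by apply: gebar_refl; apply: CW; exact: mem_nth.
by have [] := dC (i := i) (j := j); rewrite ?ij.
Qed.

Lemma chain_consecutive i z : (i.+1 < size C)%N -> gebar C`_i z -> gebar z C`_i.+1 ->
  z = C`_i \/ z = C`_i.+1.
Proof.
move=> si xz zy; have [_ Wz _] := gebar_props xz.
have zC : z \in C.
  apply: max_chain_mem => // x xC; have lt : (index x C < size C)%N by rewrite index_mem.
  rewrite -(nth_index (elt0 n m) xC); have [le|gt] := leqP (index x C) i.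
    by left; apply: gebar_trans xz; apply: chain_gebar => //; exact: ltnW.
  by right; apply: gebar_trans zy _; exact: chain_gebar.
have lt : (index z C < size C)%N by rewrite index_mem.
have zE := nth_index (elt0 n m) zC.
have [le|gt] := leqP (index z C) i.
  left; apply: gebar_anti xz; rewrite -{1}zE; apply: chain_gebar => //; exact: ltnW.
right; apply: gebar_anti zy _; rewrite -{1}zE; exact: chain_gebar.
Qed.

Lemma inWbarE I g : inWbar (wmx g, I) -> isup (P I) g /\ I \in Icol.
Proof. by case=> /= /inWup_wmx. Qed.

Lemma chain_data i : (i < size C)%N -> exists g u I, [/\ C`_i = (wmx g, I), D`_i = (wmx u, I),
  I \in Icol, isup (P I) g & isup Q u /\ mr (P I) u = g].
Proof.
move=> si; have [szD DW _ CD] := dD.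
have [g [I [E ug Ic]]] := inWbar_ex (CW (mem_nth (elt0 n m) si)).
have siD : (i < size D)%N by rewrite szD.
have [u [J [E' uu Jc]]] := inWl_ex (DW _ (mem_nth (elt0 n m) siD)).
have [] := CD _ si; rewrite E E' /= => JI; rewrite minrep_wmx => /wmx_inj ru.
by exists g, u, I; rewrite -JI; split=> //; rewrite JI.
Qed.

Lemma chain_leD i : (i.+1 < size C)%N -> leW D`_i.+1 D`_i.
Proof.
move=> si; have [szD _ dDD _] := dD.
by have [] := dDD i i.+1; rewrite ?ltnSn ?szD.
Qed.

(** [quotient_chain] gives an element of W^P between h and g, one shorter than g; maximality forces
    it to be h. *)
Lemma chain_step_eq i g h I : (i.+1 < size C)%N -> C`_i = (wmx g, I) -> C`_i.+1 = (wmx h, I) ->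
  [/\ ble h g, h <> g & len g = (len h).+1].
Proof.
move=> si xE yE; have si' := ltnW si.
have [ug Ic] : isup (P I) g /\ I \in Icol by apply: inWbarE; rewrite -xE; apply: CW; exact: mem_nth.
have [uh _] : isup (P I) h /\ I \in Icol by apply: inWbarE; rewrite -yE; apply: CW; exact: mem_nth.
have [] := dC (i := i) (j := i.+1); first by rewrite ltnSn.
rewrite xE yE => /gebar_wmx[] // _ hmx ne.
have hg : ble h g by have := isup_ble_mr uh hmx; rewrite mr_mx mr_id.
have neq : h <> g by move=> E; apply: ne; rewrite E.
split=> //; have [z [uz hz zg lz]] := quotient_chain uh ug hg neq.
have xz : gebar C`_i (wmx z, I).
  by rewrite xE; apply/gebar_wmx => //; split=> //; apply: ble_trans zg (ble_mx_self _ _).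
have zy : gebar (wmx z, I) C`_i.+1.
  by rewrite yE; apply/gebar_wmx => //; split=> //; apply: ble_trans hz (ble_mx_self _ _).
have [] := chain_consecutive si xz zy; rewrite ?xE ?yE => -[/wmx_inj zE].
  by move: lz; rewrite zE => /eqP; rewrite ltn_eqF.
by rewrite -zE.
Qed.

(** Maximality leaves no room between the two elements. The cosets of g v for index sets between J
    and I would fit there, which forces a cover and the first equality; the coset of h with index
    set I forces the second. *)
Lemma chain_step_cover i g h I J : (i.+1 < size C)%N -> C`_i = (wmx g, I) ->
  C`_i.+1 = (wmx h, J) -> J != I ->
  [/\ covers Icol J I, mr (P J) (g * vI I)%g = h, mr (P I) h = g & ble (h * vI J)%g (g * vI I)%g].
Proof.
move=> si xE yE JnI; have si' := ltnW si.
have [ug Ic] : isup (P I) g /\ I \in Icol by apply: inWbarE; rewrite -xE; apply: CW; exact: mem_nth.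
have [uh Jc] : isup (P J) h /\ J \in Icol by apply: inWbarE; rewrite -yE; apply: CW; exact: mem_nth.
have [] := dC (i := i) (j := i.+1); first by rewrite ltnSn.
rewrite xE yE => /gebar_wmx[] // JI hmx _.
have le : ble (h * vI J)%g (g * vI I)%g by apply/ble_canonical.
have hle : ble h (g * vI I)%g by apply: ble_trans (ble_vI Jc uh) le.
have btw K : K \in Icol -> J \subset K -> K \subset I ->
    (wmx (mr (P K) (g * vI I)%g), K) = (wmx g, I) \/ (wmx (mr (P K) (g * vI I)%g), K) = (wmx h, J).
  move=> Kc JK KI; rewrite -xE -yE; apply: chain_consecutive si _ _; rewrite ?xE ?yE.
    apply/gebar_wmx => //; first exact: isup_mr.
    by split=> //; apply: ble_trans (mr_ble _ _) (ble_vI_mx Ic ug).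
  apply/gebar_wmx => //; first exact: isup_mr.
  by split=> //; rewrite mx_mr; apply: ble_trans hle (ble_mx_self _ _).
split=> //.
- rewrite /covers Jc Ic properEneq JnI JI /=; apply/forall_inP => K Kc.
  apply/negP => /andP[JK KI].
  have [[_ E]|[_ E]] := btw K Kc (proper_sub JK) (proper_sub KI).
    by rewrite E properxx in KI.
  by rewrite E properxx in JK.
- have [[_ E]|[/wmx_inj //]] := btw J Jc (subxx J) JI.
  by rewrite E eqxx in JnI.
have xz : gebar C`_i (wmx (mr (P I) h), I).
  rewrite xE; apply/gebar_wmx => //; first exact: isup_mr.
  by split=> //; apply: ble_trans (mr_ble _ _) hmx.
have zy : gebar (wmx (mr (P I) h), I) C`_i.+1.
  rewrite yE; apply/gebar_wmx => //; first exact: isup_mr.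
  by split=> //; rewrite mx_mr; exact: ble_mx_self.
have [] := chain_consecutive si xz zy; rewrite ?xE ?yE => -[/wmx_inj //] _ E.
by rewrite E eqxx in JnI.
Qed.

Lemma chain_dataE i g I : (i < size C)%N -> C`_i = (wmx g, I) ->
  exists u, [/\ D`_i = (wmx u, I), I \in Icol, isup (P I) g & isup Q u /\ mr (P I) u = g].
Proof.
move=> si E; have [g' [u [J [+ E' Jc ug uu]]]] := chain_data si.
by rewrite E => -[/wmx_inj -> ->]; exists u.
Qed.

(** Otherwise (1, K) with K inside I lies below the whole chain and has to belong to it. *)
Lemma chain_last_min i g I : i.+1 = size C -> C`_i = (wmx g, I) -> ~~ [exists K in Icol, K \proper I].
Proof.
move=> iE xE; have si : (i < size C)%N by rewrite -iE.
have [u [_ Ic ug _]] := chain_dataE si xE.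
apply/negP => /exists_inP[K Kc KI].
have u1 : isup (P K) (1%g : W) by exact: isup1.
have xz : gebar C`_i (wmx (1%g : W), K).
  by rewrite xE; apply/gebar_wmx => //; split; [exact: proper_sub|exact: ble1].
have zC : (wmx (1%g : W), K) \in C.
  apply: max_chain_mem mC (inWbar_wmx Kc u1) _ => x xC; left.
  have lt : (index x C < size C)%N by rewrite index_mem.
  rewrite -(nth_index (elt0 n m) xC); apply: gebar_trans xz; apply: chain_gebar => //.
  by rewrite -ltnS iE.
have lt : (index (wmx (1%g : W), K) C < size C)%N by rewrite index_mem.
have zx : gebar (wmx (1%g : W), K) C`_i.
  by rewrite -{1}(nth_index (elt0 n m) zC); apply: chain_gebar => //; rewrite -ltnS iE.
have [_ _] := gebar_props zx; rewrite xE /= => IK.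
by move: KI; rewrite properE IK andbF.
Qed.

(** Induction on the number k of elements after position i; the projection of u to W^X is always at
    most g v. If the index set repeats, it is also at least h v, whose length is one less, and
    equality with h v would give h = g. At a cover, the next lift fixes the coset modulo W_{X_J},
    and [DQI_cover] combines it with the coset modulo W_{P_I}. *)
Lemma chain_lift_max (k : nat) i g u I : size C = (i + k.+1)%N -> C`_i = (wmx g, I) -> D`_i = (wmx u, I) ->
  mr (X I) u = (g * vI I)%g.
Proof.
elim: k i g u I => [|k IH] i g u I szE xE uE.
  have si : (i < size C)%N by rewrite szE addn1.
  have iE : i.+1 = size C by rewrite szE addn1.
  have [u' [E Ic ug [_ uP]]] := chain_dataE si xE.
  move: E uP; rewrite uE => -[/wmx_inj <-] uP.
  have XE := DQI_min hA hdom Ic (chain_last_min iE xE).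
  by rewrite -mr_mx_vI // XE uP mr_mx (mr_id ug).
have si : (i.+1 < size C)%N by rewrite szE; lia.
have si' : (i < size C)%N by exact: ltnW.
have [u' [E Ic ug [_ uP]]] := chain_dataE si' xE.
move: E uP; rewrite uE => -[/wmx_inj <-] uP.
have [h [u2 [J [yE u2E Jc uh [_ u2P]]]]] := chain_data si.
have szE' : size C = (i.+1 + k.+1)%N by rewrite szE addSnnS.
have IHy := IH i.+1 h u2 J szE' yE u2E.
have /leW_wmx[u2u JI] : leW (wmx u2, J) (wmx u, I) by rewrite -uE -u2E; exact: chain_leD.
have umx : ble u (mx (P I) g) by apply: ble_mx; apply/mrP; rewrite uP mr_id.
have ule : ble (mr (X I) u) (g * vI I)%g by rewrite -mr_mx_vI //; exact: ble_mr.
have [JE|JnI] := eqVneq J I.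
  subst J; have [hg ne lE] := chain_step_eq si xE yE.
  have hle : ble (h * vI I)%g (mr (X I) u) by rewrite -IHy; exact: ble_mr.
  apply: ble_eq ule _; rewrite leqNgt; apply/negP => lt.
  have E : (h * vI I)%g = mr (X I) u.
    apply: ble_eq hle _; move: lt.
    have vP := vI_in Ic Ic (subxx I).
    by rewrite (lenM ug vP) (lenM uh vP) lE addSn ltnS.
  apply: ne; rewrite -(mr_vI Ic uh) E mr_mr ?DQI_DP //.
have [cJI gvh _ le] := chain_step_cover si xE yE JnI.
have XJI := DQI_mono A lam Icol JI.
have EX : mr (X J) u = mr (X J) (g * vI I)%g.
  apply: ble_anti; first by rewrite -(mr_mr u XJI); exact: ble_mr.
  apply: (@ble_trans _ _ (mr (X J) u2)); last exact: ble_mr.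
  by rewrite IHy -(mr_mx_vI Jc uh); apply: ble_mr; rewrite -gvh mx_mr; exact: ble_mx_self.
have EP : mr (P I) u = mr (P I) (g * vI I)%g by rewrite uP mr_vI.
rewrite (DQI_cover hA hdom cJI) (mrI EX EP) -(DQI_cover hA hdom cJI).
by apply: mr_id; rewrite -mr_mx_vI //; exact: isup_mr.
Qed.

(** The class of w_0 with the full index set lies above every element, so it belongs to the
    chain. *)
Lemma chain_first_top g I : (0 < size C)%N -> C`_0 = (wmx g, I) -> I = setT.
Proof.
move=> s0 xE; pose t := mr (P setT) (wl W setT).
have ut : isup (P setT) t by exact: isup_mr.
have tx x : x \in C -> gebar (wmx t, setT) x.
  move=> /CW/inWbar_ex[h [J [-> uh Jc]]]; apply/gebar_wmx => //.
  by split; [exact: subsetT|rewrite mx_mr; apply: ble_trans (ble_top _) (ble_mx_self _ _)].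
have zC : (wmx t, setT) \in C.
  by apply: max_chain_mem mC (inWbar_wmx IT ut) _ => x xC; right; exact: tx.
have : gebar C`_0 (wmx t, setT).
  rewrite -[X in gebar _ X](nth_index (elt0 n m) zC); apply: chain_gebar => //.
  by rewrite index_mem.
by move/gebar_props => [_ _]; rewrite xE /= subTset => /eqP.
Qed.

(** The dual squeeze, from the top of the chain; c collects the index sets crossed on the way, each
    change being a cover. If the index set repeats, the projection of u to W^Y lies between g and h,
    which differ by one in length, and cannot be h. *)
Lemma chain_lift_min i g u I : (i < size C)%N -> C`_i = (wmx g, I) -> D`_i = (wmx u, I) ->
  exists2 c, cover_chain Icol I c & mr (Y I c) u = g.
Proof.
elim: i g u I => [|i IH] g u I si xE uE.
  have [u' [E Ic ug [_ uP]]] := chain_dataE si xE.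
  move: E uP; rewrite uE => -[/wmx_inj <-] uP.
  exists [::]; last by rewrite DQr_nil.
  by rewrite /cover_chain Ic /= (chain_first_top si xE) eqxx.
have si' : (i < size C)%N by exact: ltnW.
have [u' [E Ic ug [_ uP]]] := chain_dataE si xE.
move: E uP; rewrite uE => -[/wmx_inj <-] uP.
have [h [u2 [J [yE u2E Jc uh [_ u2P]]]]] := chain_data si'.
have [c cJ IHy] := IH h u2 J si' yE u2E.
have /leW_wmx[uu2 IJ] : leW (wmx u, I) (wmx u2, J) by rewrite -uE -u2E; exact: chain_leD.
have YJ : Y J c \subset P J by apply: DQr_sub; rewrite mem_head.
have uh' : isup (Y J c) h by apply: isup_mono uh.
have [JE|JnI] := eqVneq I J.
  subst J; have [gh ne lE] := chain_step_eq si yE xE.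
  exists c => //; have le : ble (mr (Y I c) u) h by rewrite -IHy; exact: ble_mr.
  have ge : ble g (mr (Y I c) u) by rewrite -{1}uP -(mr_mr u YJ); exact: mr_ble.
  apply/esym; apply: ble_eq ge _; rewrite leqNgt; apply/negP => lt.
  have E : mr (Y I c) u = h by apply: ble_eq le _; rewrite lE.
  by apply: ne; rewrite -uP -(mr_mr u YJ) E mr_id.
have [cIJ _ hg _] := chain_step_cover si yE xE JnI.
have cI : cover_chain Icol I (J :: c).
  by have /and3P[_ pc lc] := cJ; rewrite /cover_chain Ic /= cIJ pc lc.
exists (J :: c) => //.
have EY : mr (Y J c) u = mr (Y J c) g.
  apply: ble_anti; last by apply: ble_mr; rewrite -uP; exact: mr_ble.
  apply: (@ble_trans _ _ (mr (Y J c) u2)); first exact: ble_mr.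
  rewrite IHy -{1}(mr_id uh'); apply: ble_mr; rewrite -hg; exact: mr_ble.
have EP : mr (P I) u = mr (P I) g by rewrite uP mr_id.
rewrite DQr_cons (mrI EP EY); apply: mr_id; apply: isup_mono ug; exact: subsetIl.
Qed.

Lemma max_chain_lift i : (i < size C)%N -> D`_i = canonical_lift C`_i.
Proof.
move=> si; have [g [u [I [xE uE Ic ug [uQ uP]]]]] := chain_data si.
rewrite uE xE can_wmx //; congr (wmx _, _).
have EX : mr (X I) u = mr (X I) (g * vI I)%g.
  rewrite (@chain_lift_max (size C - i.+1) i g u I) //; last by lia.
  by apply/esym/mr_id; rewrite -mr_mx_vI //; exact: isup_mr.
have [c cI uY] := chain_lift_min si xE uE.
(* [lift_cond] enters here: v lies in W_Y, so g v and u both have the class g modulo W_Y. *)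
have EY : mr (Y I c) u = mr (Y I c) (g * vI I)%g.
  rewrite uY mr_inP; last exact: H.
  by apply/esym/mr_id; apply: isup_mono ug; apply: DQr_sub; rewrite mem_head.
have := mrI EX EY; rewrite (DQI_DQr hA hdom cI) (mr_id uQ) => ->.
apply: mr_id; apply: (@isup_mono _ _ _ (X I)); first exact: DQ_DQI.
by rewrite -mr_mx_vI //; exact: isup_mr.
Qed.

End MaximalChain.

Lemma barchain_in_max C : barchain C ->
  exists C', [/\ max_tstd_chain C', defchain C' [seq canonical_lift z | z <- C'] & {subset C <= C'}].
Proof.
move=> /barchain_tstd/tstd_extend[C' mC sub]; exists C'; split=> //.
by apply: barchain_can; case: mC => -[].
Qed.

Lemma inD_can z : inWbar z -> inD (canonical_lift z).
Proof.
move=> Wz; have [|C [mC dD sub]] := @barchain_in_max [:: z].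
  by split; [move=> x; rewrite inE => /eqP -> | move=> i j /= /andP[]; case: j].
by exists C, [seq canonical_lift z | z <- C]; split=> //; apply: map_f; apply: sub; rewrite mem_head.
Qed.

Lemma inD_ex x : inD x -> exists2 z, inWbar z & x = canonical_lift z.
Proof.
move=> [C [D [mC dD xD]]]; have [szD _ _ _] := dD.
have lt : (index x D < size C)%N by rewrite -szD index_mem.
exists (nth (elt0 n m) C (index x D)).
  by case: mC => -[[CW _] _] _; apply: CW; exact: mem_nth.
by rewrite -(max_chain_lift mC dD lt) nth_index.
Qed.

Lemma geD_can z y : inWbar z -> inWbar y -> geD (canonical_lift z) (canonical_lift y) <-> gebar z y.
Proof.
move=> Wz Wy; split=> [[le _]|zy]; first by apply/gebar_can.
split; first by case/gebar_can: zy.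
(* [undup] covers the case z = y, as a chain has no repetitions. *)
have [|C [mC dD sub]] := @barchain_in_max (undup [:: z; y]).
  split; first by move=> x; rewrite mem_undup !inE => /orP[] /eqP ->.
  rewrite /= inE; case: eqVneq => [_|ne]; first by move=> i j /= /andP[]; case: j.
  move=> i j /= /andP[]; case: j => [|[|j]] //; case: i => [|i] // _ _.
  by split=> // E; rewrite /= in E; rewrite E eqxx in ne.
exists C, [seq canonical_lift x | x <- C]; split=> //; apply: map_f; apply: sub;
  by rewrite mem_undup !inE eqxx ?orbT.
Qed.

Lemma lift_cond_standard : tau_standard A lam Icol tau.
Proof.
split=> [x y /inD_ex[z Wz ->] /inD_ex[y' Wy ->]|z Wz|x y /inD_ex[z Wz ->] /inD_ex[y' Wy ->]].
- by rewrite !rho_can // => ->.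
- by exists (canonical_lift z); split; [exact: inD_can|exact: rho_can].
by rewrite !rho_can //; exact: geD_can.
Qed.

End Canonical.

Lemma standard_unique_lift : tau_standard A lam Icol tau ->
  forall I, I \in Icol -> exists! x, inD x /\ rho x = (1%:M, I).
Proof.
move=> [inj surj _] I Ic; have [|x [xD xE]] := surj (1%:M, I).
  by rewrite -(wmx1 hA); apply: inWbar_wmx => //; exact: isup1.
by exists x; split=> // y [yD yE]; apply: inj => //; rewrite xE.
Qed.

End Chains.

Theorem mainTheorem8 (n : nat) (A : 'M[int]_n)
  (n_gt0 : (0 < n)%N)
  (hA : finite_type_cartan A) (hconn : dynkin_connected A)
  (m : nat) (lam : 'I_m -> 'cV[int]_n) (Icol : {set {set 'I_m}})
  (hdom : dominant lam) (hI : Icol_hyp Icol) :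
  let tau := minrep A (DQ A lam) (w0 A) in
  let st0 := tau_standard A lam Icol tau in
  let st1 := forall I, I \in Icol ->
      exists! x, inD A lam Icol tau x /\ rho A lam Icol x = (1%:M, I) in
  let st2 := forall I c, cover_chain Icol I c ->
      minpre A (DQ A lam) (DQI A lam Icol I) (maxpre A (DQI A lam Icol I) (DP A lam Icol I) 1%:M)
      = maxpre A (DQ A lam) (DQr A lam Icol I c) (minpre A (DQr A lam Icol I c) (DP A lam Icol I) 1%:M) in
  let st3 := forall I c, cover_chain Icol I c ->
      forall w, inWJ A (DP A lam Icol I) w -> inWup A (DQI A lam Icol I) w ->
        inWJ A (DQr A lam Icol I c) w /\ inWup A (DQ A lam) w in
  let st4 := forall I c, cover_chain Icol I c ->
      DQI A lam Icol I :|: DQr A lam Icol I c = DP A lam Icol I /\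
      forall (x : 'I_n) (p : seq 'I_n),
        path (dynkin_adj A) x p -> uniq (x :: p) ->
        x \in DQI A lam Icol I :\: DQr A lam Icol I c ->
        last x p \in DQr A lam Icol I c :\: DQI A lam Icol I ->
        has (fun v => v \notin DP A lam Icol I) (x :: p) in
  [/\ st0 <-> st1, st0 <-> st2, st0 <-> st3 & st0 <-> st4].

Proof.
move=> tau st0 st1 st2 st3 st4; have [_ _ IT _] := hI.
have h01 : st0 -> st1 by exact: (standard_unique_lift hA).
have h1 : st1 -> lift_cond hA lam Icol by exact: unique_lift_cond.
have h0 : lift_cond hA lam Icol -> st0 by exact: lift_cond_standard.
have h2 : st2 <-> lift_cond hA lam Icol by exact: extremal_lift_cond.
have h3 : st3 <-> lift_cond hA lam Icol by exact: parabolic_lift_cond.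
have h4 : st4 <-> lift_cond hA lam Icol by exact: path_lift_cond.
by split; tauto.
Qed.
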